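(* Let $0<q<1$ and $\phi\in[0,2\pi)$, and write $H=\mathcal U_{q,\phi}(\hat u(2))$, $A=SU_{q,\phi}(2)$, with $\Xi(h\otimes a)=e^{2i\phi\delta(h)\delta(a)}a\otimes h$ on homogeneous elements. There is a braided pairing $\langle\cdot,\cdot\rangle:H\otimes A\to\mathbb C$ (with respect to $\Xi$) given on generators by $$\langle e,\gamma^*\rangle=-q^{-1}e^{-4i\phi},\qquad\langle f,\gamma\rangle=1,$$ $$\langle k,\alpha\rangle=q^{-1/2}e^{2i\phi},\quad\langle k,\alpha^*\rangle=q^{1/2}e^{-2i\phi},\quad\langle k^*,\alpha\rangle=q^{-1/2}e^{-2i\phi},\quad\langle k^*,\alpha^*\rangle=q^{1/2}e^{2i\phi},$$ $$\langle k^{-1},\alpha\rangle=q^{1/2}e^{-2i\phi},\quad\langle k^{-1},\alpha^*\rangle=q^{-1/2}e^{2i\phi},\quad\langle (k^* )^{-1},\alpha\rangle=q^{1/2}e^{2i\phi},\quad\langle (k^* )^{-1},\alpha^*\rangle=q^{-1/2}e^{-2i\phi},$$ with all other pairings of generators vanishing, and it moreover satisfies $$(\mathrm{id}_A\otimes\langle\cdot,\cdot\rangle)(\Xi\otimes\mathrm{id}_A)(\mathrm{id}_H\otimes\Psi_A)=\langle\cdot,\cdot\rangle\otimes\mathrm{id}_A,\qquad(\langle\cdot,\cdot\rangle\otimes\mathrm{id}_H)(\mathrm{id}_H\otimes\Xi)(\Psi_H\otimes\mathrm{id}_A)=\mathrm{id}_H\otimes\langle\cdot,\cdot\rangle .$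$
   Context: $SU_{q,\phi}(2)$ is the braided Hopf algebra over $\mathbb C$ generated by $\alpha,\gamma,\alpha^*,\gamma^*$ with relations $\alpha\gamma=qe^{4i\phi}\gamma\alpha$, $\alpha\gamma^*=qe^{-4i\phi}\gamma^*\alpha$, $\gamma\alpha^*=qe^{4i\phi}\alpha^*\gamma$, $\gamma^*\alpha^*=qe^{-4i\phi}\alpha^*\gamma^*$, $\alpha\alpha^*+q^2\gamma^*\gamma=1$, $\alpha^*\alpha+\gamma\gamma^*=1$, $\gamma\gamma^*=\gamma^*\gamma$; coproduct $\Delta(\alpha)=\alpha\otimes\alpha-qe^{-4i\phi}\gamma^*\otimes\gamma$, $\Delta(\gamma)=\gamma\otimes\alpha+\alpha^*\otimes\gamma$, $\Delta(\alpha^* )=\alpha^*\otimes\alpha^*-qe^{-4i\phi}\gamma\otimes\gamma^*$, $\Delta(\gamma^* )=\gamma^*\otimes\alpha^*+\alpha\otimes\gamma^*$; counit $\epsilon(\alpha)=\epsilon(\alpha^* )=1$, $\epsilon(\gamma)=\epsilon(\gamma^* )=0$; antipode $S(\alpha)=\alpha^*$, $S(\alpha^* )=\alpha$, $S(\gamma)=-qe^{4i\phi}\gamma$, $S(\gamma^* )=-q^{-1}e^{4i\phi}\gamma^*$; its index $\delta$ is the $\mathbb Z$-grading, additive on products, with $\delta(\alpha)=\delta(\alpha^* )=0$, $\delta(\gamma)=-2$, $\delta(\gamma^* )=2$, and its braiding is $\Psi_A(a\otimes b)=e^{2i\phi\delta(a)\delta(b)}b\otimes a$ on homogeneous elements.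 $\mathcal U_{q,\phi}(\hat u(2))$ is the braided Hopf $*$-algebra over $\mathbb C$ generated by $e$, $f=e^*$ and invertible $k,k^*$ with relations $ek=qe^{-4i\phi}ke$, $kf=qe^{-4i\phi}fk$, $k^*f=qe^{4i\phi}fk^*$, $ek^*=qe^{4i\phi}k^*e$, $kk^*=k^*k$, $ef-fe=\frac1{q^{-1}-q}\left(kk^*-k^{-1}(k^* )^{-1}\right)$; coproduct $\Delta(k)=k\otimes k$, $\Delta(k^* )=k^*\otimes k^*$, $\Delta(e)=e\otimes k+k^{-1}\otimes e$, $\Delta(f)=f\otimes k^*+(k^* )^{-1}\otimes f$; counit $\epsilon(e)=\epsilon(f)=0$, $\epsilon(k)=\epsilon(k^* )=1$; antipode $S(e)=-q^{-1}e^{4i\phi}e$, $S(f)=-qe^{4i\phi}f$, $S(k)=k^{-1}$, $S(k^* )=(k^* )^{-1}$; its index $\delta$ is the $\mathbb Z$-grading, additive on products, with $\delta(e)=-2$, $\delta(f)=2$, $\delta(k)=\delta(k^* )=0$, and its braiding is $\Psi_H(x\otimes y)=e^{2i\phi\delta(x)\delta(y)}y\otimes x$ on homogeneous elements. In both cases the coproduct is an algebra homomorphism into the braided tensor product, where $(a\otimes b)(c\otimes d)=a\,\Psi(b\otimes c)\,d$, and the antipode extends to products by $S\circ\cdot=\cdot\circ\Psi\circ(S\otimes S)$. A linear map $\langle\cdot,\cdot\rangle:H\otimes A\to\mathbb C$ is a braided pairing (with respect to $\Xi:H\otimes A\to A\otimes H$, a braiding compatible with products and coproducts of $H$ and $A$)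 if $\langle\cdot,\cdot\rangle(\mathrm{id}\otimes\cdot_A)=(\langle\cdot,\cdot\rangle\otimes\langle\cdot,\cdot\rangle)(\mathrm{id}\otimes\Xi\otimes\mathrm{id})(\Delta_H\otimes\mathrm{id}\otimes\mathrm{id})$ on $H\otimes A\otimes A$, $\langle\cdot,\cdot\rangle(\cdot_H\otimes\mathrm{id})=(\langle\cdot,\cdot\rangle\otimes\langle\cdot,\cdot\rangle)(\mathrm{id}\otimes\Xi\otimes\mathrm{id})(\mathrm{id}\otimes\mathrm{id}\otimes\Delta_A)$ on $H\otimes H\otimes A$, $\langle Sh,a\rangle=\langle h,Sa\rangle$, and $\langle1,a\rangle=\epsilon(a)$, $\langle h,1\rangle=\epsilon(h)$ for all $h\in H$, $a\in A$. *)

(* Defs.v *)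
From HB Require Import structures.
From mathcomp Require Import all_boot all_order all_algebra.
From mathcomp Require Import complex.
From mathcomp Require Import boolp reals trigo ring.

Set Implicit Arguments.
Unset Strict Implicit.
Unset Printing Implicit Defensive.

Import Order.TTheory GRing.Theory Num.Theory.
Local Open Scope ring_scope.
Local Open Scope quotient_scope.

Declare Scope nc_scope.
Delimit Scope nc_scope with NC.
Reserved Notation "U \ot V" (at level 40, left associativity).

(* * Tensor product of two modules: formal linear combinations of pairs, modulo
   the congruence generated by the module axioms and bilinearity. *)
Section Tensor.
Variables (K : fieldType) (U V : lmodType K).

Inductive tterm :=
  | TPure of U & V
  | TZero
  | TAdd of tterm & tterm
  | TScale of K & tterm.

Inductive tcong : tterm -> tterm -> Prop :=
  | tcong_refl s : tcong s s
  | tcong_sym s t : tcong s t -> tcong t s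
  | tcong_trans s t r : tcong s t -> tcong t r -> tcong s r
  | tcong_add s s' t t' :
      tcong s s' -> tcong t t' -> tcong (TAdd s t) (TAdd s' t')
  | tcong_scale a s s' : tcong s s' -> tcong (TScale a s) (TScale a s')
  | tcong_addA s t r : tcong (TAdd s (TAdd t r)) (TAdd (TAdd s t) r)
  | tcong_addC s t : tcong (TAdd s t) (TAdd t s)
  | tcong_add0 s : tcong (TAdd TZero s) s
  | tcong_addN s : tcong (TAdd (TScale (-1) s) s) TZero
  | tcong_scaleA a b s : tcong (TScale a (TScale b s)) (TScale (a * b) s)
  | tcong_scale1 s : tcong (TScale 1 s) s
  | tcong_scaleDr a s t :
      tcong (TScale a (TAdd s t)) (TAdd (TScale a s) (TScale a t))
  | tcong_scaleDl a b s :
      tcong (TScale (a + b) s) (TAdd (TScale a s) (TScale b s))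
  | tcong_pureDl u u' v :
      tcong (TPure (u + u') v) (TAdd (TPure u v) (TPure u' v))
  | tcong_pureDr u v v' :
      tcong (TPure u (v + v')) (TAdd (TPure u v) (TPure u v'))
  | tcong_pureZl a u v : tcong (TPure (a *: u) v) (TScale a (TPure u v))
  | tcong_pureZr a u v : tcong (TPure u (a *: v)) (TScale a (TPure u v)).

HB.instance Definition _ := gen_eqMixin tterm.
HB.instance Definition _ := gen_choiceMixin tterm.

Definition tcongb s t := `[< tcong s t >].
Lemma tcongb_equiv : equiv_class_of tcongb.
Proof.
split=> [s|s t|s t r]; first exact/asboolP/tcong_refl.
  by apply/asboolP/asboolP; apply: tcong_sym.
by move=> /asboolP st /asboolP tr; apply/asboolP/(tcong_trans st tr).
Qed.
Canonical tcong_equiv := EquivRelPack tcongb_equiv.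

Definition tens := {eq_quot tcong_equiv}.
HB.instance Definition _ := Choice.on tens.
HB.instance Definition _ := EqQuotient.on tens.

Definition tpi (s : tterm) : tens := \pi_tens s.

Lemma tpiP s t : tcong s t <-> tpi s = tpi t.
Proof. by split=> [st|/eqmodP/asboolP//]; apply/eqmodP/asboolP. Qed.

Lemma tpi_surj (x : tens) : exists s, x = tpi s.
Proof. by exists (repr x); rewrite /tpi reprK. Qed.

Lemma tcong_repr s : tcong (repr (tpi s)) s.
Proof. by apply/tpiP; rewrite /tpi reprK. Qed.

Definition tadd (x y : tens) := tpi (TAdd (repr x) (repr y)).
Definition tscale a (x : tens) := tpi (TScale a (repr x)).

Lemma tpiD s t : tadd (tpi s) (tpi t) = tpi (TAdd s t).
Proof. by apply/tpiP/tcong_add; apply: tcong_repr. Qed.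
Lemma tpiZ a s : tscale a (tpi s) = tpi (TScale a s).
Proof. by apply/tpiP/tcong_scale/tcong_repr. Qed.

Ltac tens_ax :=
  repeat (let x := fresh in move=> x;
    try (have [? ->] := tpi_surj x));
  rewrite ?(tpiD, tpiZ); apply/tpiP.

Lemma taddA : associative tadd.
Proof. by tens_ax; apply: tcong_addA. Qed.
Lemma taddC : commutative tadd.
Proof. by tens_ax; apply: tcong_addC. Qed.
Lemma tadd0 : left_id (tpi TZero) tadd.
Proof. by tens_ax; apply: tcong_add0. Qed.
Lemma taddN : left_inverse (tpi TZero) (tscale (-1)) tadd.
Proof. by tens_ax; apply: tcong_addN. Qed.

HB.instance Definition _ := GRing.isZmodule.Build tens taddA taddC tadd0 taddN.

Lemma tscaleA a b x : tscale a (tscale b x) = tscale (a * b) x.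
Proof. by move: x; tens_ax; apply: tcong_scaleA. Qed.
Lemma tscale1 : left_id 1 tscale.
Proof. by tens_ax; apply: tcong_scale1. Qed.
Lemma tscaleDr : right_distributive tscale +%R.
Proof.
move=> a x y; rewrite /GRing.add /=.
by move: x y; tens_ax; apply: tcong_scaleDr.
Qed.
Lemma tscaleDl x : {morph tscale^~ x : a b / a + b}.
Proof.
move=> a b; rewrite [RHS]/GRing.add /=.
by move: x; tens_ax; apply: tcong_scaleDl.
Qed.

HB.instance Definition _ :=
  GRing.Zmodule_isLmodule.Build K tens tscaleA tscale1 tscaleDr tscaleDl.

Definition pure (u : U) (v : V) : tens := tpi (TPure u v).

Lemma tpi_add s t : tpi (TAdd s t) = tpi s + tpi t.
Proof. by rewrite -tpiD. Qed.
Lemma tpi_scale a s : tpi (TScale a s) = a *: tpi s.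
Proof. by rewrite -tpiZ. Qed.

Lemma pureDl u u' v : pure (u + u') v = pure u v + pure u' v.
Proof. by rewrite -tpi_add; apply/tpiP/tcong_pureDl. Qed.
Lemma pureDr u v v' : pure u (v + v') = pure u v + pure u v'.
Proof. by rewrite -tpi_add; apply/tpiP/tcong_pureDr. Qed.
Lemma pureZl a u v : pure (a *: u) v = a *: pure u v.
Proof. by rewrite -tpi_scale; apply/tpiP/tcong_pureZl. Qed.
Lemma pureZr a u v : pure u (a *: v) = a *: pure u v.
Proof. by rewrite -tpi_scale; apply/tpiP/tcong_pureZr. Qed.
Lemma pure0l v : pure 0 v = 0.
Proof. by rewrite -(scale0r 0) pureZl scale0r. Qed.
Lemma pure0r u : pure u 0 = 0.
Proof. by rewrite -(scale0r 0) pureZr scale0r. Qed.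
Lemma pureNl u v : pure (- u) v = - pure u v.
Proof. by rewrite -scaleN1r pureZl scaleN1r. Qed.
Lemma pureNr u v : pure u (- v) = - pure u v.
Proof. by rewrite -scaleN1r pureZr scaleN1r. Qed.

Lemma tens_ind (Q : tens -> Prop) :
  (forall u v, Q (pure u v)) -> (forall x y, Q x -> Q y -> Q (x + y)) ->
  forall x, Q x.
Proof.
move=> Qp QD x; have [s ->] := tpi_surj x.
suff: forall a, Q (a *: tpi s) by move/(_ 1); rewrite scale1r.
elim: s => [u v|||] => [a||s IHs t IHt a|b s IHs a].
- by rewrite -pureZl.
- by move=> a; rewrite scaler0 -(pure0l 0).
- by rewrite tpi_add scalerDr; apply: QD.
- by rewrite tpi_scale scalerA; apply: IHs.
Qed.

Lemma tens_ext (W : lmodType K) (f g : {linear tens -> W}) :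
  (forall u v, f (pure u v) = g (pure u v)) -> f =1 g.
Proof.
by move=> fg; elim/tens_ind=> // x y fx fy; rewrite !linearD fx fy.
Qed.

Section Lift.
Variables (W : lmodType K) (f : U -> V -> W).
Hypothesis bf : bilinear_for *:%R *:%R f.

Fixpoint teval s : W := match s with
  | TPure u v => f u v
  | TZero => 0
  | TAdd s t => teval s + teval t
  | TScale a s => a *: teval s
  end.

Lemma teval_cong s t : tcong s t -> teval s = teval t.
Proof.
have [fl fr] := bf.
have fDl u u' v : f (u + u') v = f u v + f u' v.
  by have := fl v 1 u u'; rewrite /= !scale1r.
have fDr u v v' : f u (v + v') = f u v + f u v'.
  by have := fr u 1 v v'; rewrite /= !scale1r.
have f0l v : f 0 v = 0 by apply: (addrI (f 0 v)); rewrite -fDl !addr0.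
have f0r u : f u 0 = 0 by apply: (addrI (f u 0)); rewrite -fDr !addr0.
have fZl a u v : f (a *: u) v = a *: f u v.
  by have := fl v a u 0; rewrite /= !addr0 f0l addr0.
have fZr a u v : f u (a *: v) = a *: f u v.
  by have := fr u a v 0; rewrite /= !addr0 f0r addr0.
elim=> //=.
- by move=> ? ? ? _ -> _ ->.
- by move=> ? ? ? ? _ -> _ ->.
- by move=> ? ? ? _ ->.
- by move=> *; rewrite addrA.
- by move=> *; rewrite addrC.
- by move=> *; rewrite add0r.
- by move=> *; rewrite scaleN1r addNr.
- by move=> *; rewrite scalerA.
- by move=> *; rewrite scale1r.
- by move=> *; rewrite scalerDr.
- by move=> *; rewrite scalerDl.
Qed.

Definition tlift_fun (x : tens) : W := teval (repr x).

Lemma tlift_pi s : tlift_fun (tpi s) = teval s.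
Proof. exact/teval_cong/tcong_repr. Qed.

Lemma tlift_linear : linear tlift_fun.
Proof.
move=> a x y; have [s ->] := tpi_surj x; have [t ->] := tpi_surj y.
by rewrite -tpi_scale -tpi_add !tlift_pi.
Qed.

End Lift.
End Tensor.

Notation "U \ot V" := (tens U%type V%type) : type_scope.
Notation "u \ot v" := (pure u v) : ring_scope.

Section TensorMaps.
Variable K : fieldType.
Implicit Types U V W : lmodType K.

Definition tlift U V W (f : U -> V -> W)
    (bf : bilinear_for *:%R *:%R f) : U \ot V -> W :=
  let _ := bf in tlift_fun f.
HB.instance Definition _ U V W (f : U -> V -> W)
    (bf : bilinear_for *:%R *:%R f) :=
  GRing.isLinear.Build K (U \ot V)%type W *:%R (tlift bf) (tlift_linear bf).

Lemma tliftE U V W (f : U -> V -> W) (bf : bilinear_for *:%R *:%R f) u v :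
  tlift bf (u \ot v) = f u v.
Proof. by rewrite /tlift tlift_pi. Qed.

(* f \otimes g *)
Section Tmap.
Variables (U U' V V' : lmodType K) (f : {linear U -> U'}) (g : {linear V -> V'}).
Lemma tmap_bilinear :
  bilinear_for *:%R *:%R (fun u v => f u \ot g v : U' \ot V').
Proof.
split=> [v|u] a x y /=; first by rewrite linearP pureDl pureZl.
by rewrite linearP pureDr pureZr.
Qed.
Definition tmap : U \ot V -> U' \ot V' := tlift tmap_bilinear.
HB.instance Definition _ := GRing.Linear.on tmap.
Lemma tmapE u v : tmap (u \ot v) = f u \ot g v.
Proof. exact: tliftE. Qed.
End Tmap.

Section Assoc.
Variables U V W : lmodType K.

Lemma assoc_inner_bilinear (w : W) :
  bilinear_for *:%R *:%R (fun (u : U) (v : V) => u \ot (v \ot w)).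
Proof.
by split=> [v|u] a x y /=; rewrite ?(pureDl, pureZl, pureDr, pureZr).
Qed.
Lemma assoc_bilinear : bilinear_for *:%R *:%R
  (fun (x : U \ot V) (w : W) => tlift (assoc_inner_bilinear w) x).
Proof.
split=> [w|x] a y z /=; first by rewrite linearP.
elim/tens_ind: x => [u v|x x' IH IH'].
  by rewrite !tliftE ?(pureDl, pureZl, pureDr, pureZr).
by rewrite !linearD /= IH IH' addrACA.
Qed.
(* (u \otimes v) \otimes w |-> u \otimes (v \otimes w) *)
Definition tassoc : U \ot V \ot W -> U \ot (V \ot W) := tlift assoc_bilinear.
HB.instance Definition _ := GRing.Linear.on tassoc.
Lemma tassocE u v w : tassoc (u \ot v \ot w) = u \ot (v \ot w).
Proof. by rewrite /tassoc !tliftE. Qed.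

Lemma unassoc_inner_bilinear (u : U) :
  bilinear_for *:%R *:%R (fun (v : V) (w : W) => u \ot v \ot w).
Proof.
by split=> [v|v] a x y /=; rewrite ?(pureDl, pureZl, pureDr, pureZr).
Qed.
Lemma unassoc_bilinear : bilinear_for *:%R *:%R
  (fun (u : U) (x : V \ot W) => tlift (unassoc_inner_bilinear u) x).
Proof.
split=> [x|u] a y z /=; last by rewrite linearP.
elim/tens_ind: x => [v w|x x' IH IH'].
  by rewrite !tliftE ?(pureDl, pureZl, pureDr, pureZr).
by rewrite !linearD /= IH IH' addrACA.
Qed.
Definition tunassoc : U \ot (V \ot W) -> U \ot V \ot W :=
  tlift unassoc_bilinear.
HB.instance Definition _ := GRing.Linear.on tunassoc.
Lemma tunassocE u v w : tunassoc (u \ot (v \ot w)) = u \ot v \ot w.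
Proof. by rewrite /tunassoc !tliftE. Qed.
End Assoc.

Section Unit.
Variable U : lmodType K.
Lemma lunit_bilinear : bilinear_for *:%R *:%R (fun (a : K^o) (u : U) => a *: u).
Proof.
split=> [u|a] b x y /=; first by rewrite scalerDl scalerA.
by rewrite scalerDr !scalerA mulrC.
Qed.
(* the canonical isomorphism K \otimes U = U *)
Definition lunit : K^o \ot U -> U := tlift lunit_bilinear.
HB.instance Definition _ := GRing.Linear.on lunit.
Lemma lunitE a u : lunit (a \ot u) = a *: u.
Proof. by rewrite /lunit tliftE. Qed.

Lemma runit_bilinear : bilinear_for *:%R *:%R (fun (u : U) (a : K^o) => a *: u).
Proof.
split=> [a|u] b x y /=; last by rewrite scalerDl scalerA.
by rewrite scalerDr !scalerA mulrC.
Qed.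
Definition runit : U \ot K^o -> U := tlift runit_bilinear.
HB.instance Definition _ := GRing.Linear.on runit.
Lemma runitE a u : runit (u \ot a) = a *: u.
Proof. by rewrite /runit tliftE. Qed.
End Unit.

Section Mul.
Variable B : algType K.
Lemma mul_bilinear : bilinear_for *:%R *:%R (fun x y : B => x * y).
Proof.
split=> [y|x] a z t /=; first by rewrite mulrDl scalerAl.
by rewrite mulrDr scalerAr.
Qed.
Definition tmul : B \ot B -> B := tlift mul_bilinear.
HB.instance Definition _ := GRing.Linear.on tmul.
Lemma tmulE x y : tmul (x \ot y) = x * y.
Proof. by rewrite /tmul tliftE. Qed.

Lemma mull_linear (y : B) : linear (fun x : B => y * x).
Proof. by move=> a u v; rewrite mulrDr scalerAr. Qed.
Definition mull (y x : B) := y * x.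
HB.instance Definition _ (y : B) :=
  GRing.isLinear.Build K B B *:%R (mull y) (mull_linear y).

End Mul.

(* id \otimes X \otimes id *)
Section Mid.
Variables (U V W V' W' Z : lmodType K) (X : {linear (V \ot W)%type -> (W' \ot V')%type}).
Definition tmid : U \ot V \ot (W \ot Z) -> U \ot W' \ot (V' \ot Z) :=
  @tunassoc U W' (V' \ot Z)%type
    \o tmap (@idfun U) (@tassoc W' V' Z \o tmap X (@idfun Z) \o @tunassoc V W Z)
    \o @tassoc U V (W \ot Z)%type.
HB.instance Definition _ := GRing.Linear.on tmid.
Lemma tmidE u v w z a v' w' : X (v \ot w) = a *: (w' \ot v') ->
  tmid (u \ot v \ot (w \ot z)) = a *: (u \ot w' \ot (v' \ot z)).
Proof.
move=> Xvw; rewrite /tmid /= tassocE tmapE /= tunassocE tmapE Xvw /=.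
by rewrite pureZl linearZ /= tassocE pureZr linearZ /= tunassocE.
Qed.
End Mid.

End TensorMaps.

(* * Algebras presented by generators and relations *)

(* Noncommutative polynomial expressions in generators x : X *)
Section Terms.
Variables (K : fieldType) (X : Type).

Inductive term :=
  | Gen of X
  | Cst of K
  | Add of term & term
  | Mul of term & term.

Definition Scale a t := Mul (Cst a) t.
Definition Opp t := Scale (-1) t.

HB.instance Definition _ := gen_eqMixin term.
HB.instance Definition _ := gen_choiceMixin term.

Section Eval.
Variables (B : algType K) (f : X -> B).
Fixpoint eval t : B := match t with
  | Gen x => f x
  | Cst a => a%:A
  | Add s t => eval s + eval t
  | Mul s t => eval s * eval t
  end.
End Eval.

(* [thomog deg n t]: t is homogeneous of degree n for the Z-grading that is
   additive on products and takes the values deg on generators *)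
Inductive thomog (deg : X -> int) : int -> term -> Prop :=
  | thomog_gen x : thomog deg (deg x) (Gen x)
  | thomog_cst a : thomog deg 0 (Cst a)
  | thomog_zero n : thomog deg n (Cst 0)
  | thomog_add n s t :
      thomog deg n s -> thomog deg n t -> thomog deg n (Add s t)
  | thomog_mul m n s t :
      thomog deg m s -> thomog deg n t -> thomog deg (m + n) (Mul s t).

End Terms.

Arguments Cst {K X} a.
Arguments Gen {K X} x.

Notation "s + t" := (Add s t) : nc_scope.
Notation "s - t" := (Add s (Opp t)) : nc_scope.
Notation "s * t" := (Mul s t) : nc_scope.
Notation "a *: t" := (Scale a%R t) : nc_scope.
Notation "1" := (Cst 1%R) : nc_scope.

(* Generators with their degrees, homogeneous relations, and the values on the
   generators of an algebra map to K (which is going to be the counit; its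
   existence makes the presented algebra nontrivial). *)
Record presentation (K : fieldType) := Presentation {
  gens : Type;
  deg : gens -> int;
  rels : term K gens -> term K gens -> Prop;
  counit_gen : gens -> K^o;
  rels_homog : forall s t, rels s t ->
    exists n, thomog deg n s /\ thomog deg n t;
  rels_counit : forall s t, rels s t ->
    eval counit_gen s = eval counit_gen t
}.
Arguments deg {K p}.
Arguments rels {K p}.
Arguments counit_gen {K p}.

Section Alg.
Variables (K : fieldType) (P : presentation K).
Local Notation term := (term K (gens P)).

(* The congruence generated by the algebra axioms and the relations of P *)
Inductive cong : term -> term -> Prop :=
  | cong_refl s : cong s s
  | cong_sym s t : cong s t -> cong t s
  | cong_trans s t r : cong s t -> cong t r -> cong s r
  | cong_add s s' t t' : cong s s' -> cong t t' -> cong (s + t)%NC (s' + t')%NC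
  | cong_mul s s' t t' : cong s s' -> cong t t' -> cong (s * t)%NC (s' * t')%NC
  | cong_addA s t r : cong (s + (t + r))%NC (s + t + r)%NC
  | cong_addC s t : cong (s + t)%NC (t + s)%NC
  | cong_add0 s : cong (Cst 0 + s)%NC s
  | cong_mulA s t r : cong (s * (t * r))%NC (s * t * r)%NC
  | cong_mul1 s : cong (1 * s)%NC s
  | cong_mul0 s : cong (Cst 0 * s)%NC (Cst 0)
  | cong_mulDl s t r : cong ((s + t) * r)%NC (s * r + t * r)%NC
  | cong_mulDr s t r : cong (s * (t + r))%NC (s * t + s * r)%NC
  | cong_cstD a b : cong (Cst (a + b)) (Cst a + Cst b)%NC
  | cong_cstM a b : cong (Cst (a * b)) (Cst a * Cst b)%NC
  | cong_cstC a s : cong (Cst a * s)%NC (s * Cst a)%NC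
  | cong_rel s t : rels s t -> cong s t.

Lemma eval_cong (B : algType K) (f : gens P -> B) :
  (forall s t, rels s t -> eval f s = eval f t) ->
  forall s t, cong s t -> eval f s = eval f t.
Proof.
move=> fR s t; elim=> //=.
- by move=> ? ? ? _ -> _ ->.
- by move=> ? ? ? ? _ -> _ ->.
- by move=> ? ? ? ? _ -> _ ->.
- by move=> *; rewrite addrA.
- by move=> *; rewrite addrC.
- by move=> *; rewrite scale0r add0r.
- by move=> *; rewrite mulrA.
- by move=> *; rewrite scale1r mul1r.
- by move=> *; rewrite scale0r mul0r.
- by move=> *; rewrite mulrDl.
- by move=> *; rewrite mulrDr.
- by move=> *; rewrite scalerDl.
- by move=> *; rewrite mulr_algl scalerA.
- by move=> *; rewrite mulr_algl mulr_algr.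
Qed.

Definition congb s t := `[< cong s t >].
Lemma congb_equiv : equiv_class_of congb.
Proof.
split=> [s|s t|s t r]; first exact/asboolP/cong_refl.
  by apply/asboolP/asboolP; apply: cong_sym.
by move=> /asboolP st /asboolP tr; apply/asboolP/(cong_trans st tr).
Qed.
Canonical cong_equiv := EquivRelPack congb_equiv.

Definition alg := {eq_quot cong_equiv}.
HB.instance Definition _ := Choice.on alg.
HB.instance Definition _ := EqQuotient.on alg.

(* the class of an expression *)
Definition cls (s : term) : alg := \pi_alg s.

Lemma clsP s t : cong s t <-> cls s = cls t.
Proof. by split=> [st|/eqmodP/asboolP//]; apply/eqmodP/asboolP. Qed.
Lemma cls_surj (x : alg) : exists s, x = cls s.
Proof. by exists (repr x); rewrite /cls reprK. Qed.
Lemma cong_repr s : cong (repr (cls s)) s.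
Proof. by apply/clsP; rewrite /cls reprK. Qed.

Definition alg_add (x y : alg) := cls (repr x + repr y)%NC.
Definition alg_mul (x y : alg) := cls (repr x * repr y)%NC.
Definition alg_opp (x : alg) := cls (Opp (repr x)).
Definition alg_scale a (x : alg) := cls (a *: repr x)%NC.

Lemma alg_addE s t : alg_add (cls s) (cls t) = cls (s + t)%NC.
Proof. by apply/clsP/cong_add; apply: cong_repr. Qed.
Lemma alg_mulE s t : alg_mul (cls s) (cls t) = cls (s * t)%NC.
Proof. by apply/clsP/cong_mul; apply: cong_repr. Qed.
Lemma alg_scaleE a s : alg_scale a (cls s) = cls (a *: s)%NC.
Proof. by apply/clsP/cong_mul; [apply: cong_refl|apply: cong_repr]. Qed.
Lemma alg_oppE s : alg_opp (cls s) = cls (Opp s).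
Proof. exact: alg_scaleE. Qed.

Ltac alg_ax :=
  repeat (let x := fresh in move=> x;
    try (have [? ->] := cls_surj x));
  rewrite ?(alg_addE, alg_mulE, alg_scaleE, alg_oppE); apply/clsP.

Lemma alg_addA : associative alg_add.
Proof. by alg_ax; apply: cong_addA. Qed.
Lemma alg_addC : commutative alg_add.
Proof. by alg_ax; apply: cong_addC. Qed.
Lemma alg_add0 : left_id (cls (Cst 0)) alg_add.
Proof. by alg_ax; apply: cong_add0. Qed.
Lemma alg_addN : left_inverse (cls (Cst 0)) alg_opp alg_add.
Proof.
move=> x; have [s ->] := cls_surj x; rewrite alg_oppE alg_addE; apply/clsP.
apply: (cong_trans (t := (Cst (-1) * s + 1 * s)%NC)).
  by apply: cong_add; [apply: cong_refl|apply/cong_sym/cong_mul1].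
apply: (cong_trans (cong_sym (cong_mulDl _ _ _))).
apply: (cong_trans _ (cong_mul0 s)).
apply: cong_mul; last exact: cong_refl.
by rewrite -(addNr (1 : K)); apply/cong_sym/cong_cstD.
Qed.
HB.instance Definition _ :=
  GRing.isZmodule.Build alg alg_addA alg_addC alg_add0 alg_addN.

Lemma clsD s t : cls (s + t)%NC = cls s + cls t.
Proof. by rewrite -alg_addE. Qed.

Lemma alg_mulA : associative alg_mul.
Proof. by alg_ax; apply: cong_mulA. Qed.
Lemma alg_mul1r : left_id (cls 1%NC) alg_mul.
Proof. by alg_ax; apply: cong_mul1. Qed.
Lemma alg_mulr1 : right_id (cls 1%NC) alg_mul.
Proof. by alg_ax; apply: (cong_trans (cong_sym (cong_cstC _ _)) (cong_mul1 _)). Qed.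
Lemma alg_mulDl : left_distributive alg_mul +%R.
Proof.
move=> x y z; have [r ->] := cls_surj x; have [s ->] := cls_surj y.
have [t ->] := cls_surj z; rewrite -clsD !alg_mulE -clsD.
exact/clsP/cong_mulDl.
Qed.
Lemma alg_mulDr : right_distributive alg_mul +%R.
Proof.
move=> x y z; have [r ->] := cls_surj x; have [s ->] := cls_surj y.
have [t ->] := cls_surj z; rewrite -clsD !alg_mulE -clsD.
exact/clsP/cong_mulDr.
Qed.
Lemma alg_one_neq0 : cls 1%NC != 0.
Proof.
apply/eqP => /clsP /(eval_cong (@rels_counit _ P)) /=.
by rewrite scale1r scale0r => /eqP; rewrite oner_eq0.
Qed.
HB.instance Definition _ := GRing.Zmodule_isNzRing.Build alg
  alg_mulA alg_mul1r alg_mulr1 alg_mulDl alg_mulDr alg_one_neq0.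

Lemma alg_scaleA a b x : alg_scale a (alg_scale b x) = alg_scale (a * b) x.
Proof.
have [s ->] := cls_surj x; rewrite !alg_scaleE; apply/clsP.
apply: (cong_trans (cong_mulA _ _ _)).
by apply: cong_mul (cong_refl _); apply/cong_sym/cong_cstM.
Qed.
Lemma alg_scale1 : left_id 1 alg_scale.
Proof. by alg_ax; apply: cong_mul1. Qed.
Lemma alg_scaleDr : right_distributive alg_scale +%R.
Proof.
move=> a x y; have [s ->] := cls_surj x; have [t ->] := cls_surj y.
rewrite -clsD !alg_scaleE -clsD; exact/clsP/cong_mulDr.
Qed.
Lemma alg_scaleDl x : {morph alg_scale^~ x : a b / a + b}.
Proof.
move=> a b; have [s ->] := cls_surj x; rewrite !alg_scaleE -clsD; apply/clsP.
apply: (cong_trans _ (cong_mulDl _ _ _)).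
by apply: cong_mul (cong_refl _); apply: cong_cstD.
Qed.
HB.instance Definition _ := GRing.Zmodule_isLmodule.Build K alg
  alg_scaleA alg_scale1 alg_scaleDr alg_scaleDl.

Lemma alg_scaleAl a (x y : alg) : a *: (x * y) = a *: x * y.
Proof.
have [s ->] := cls_surj x; have [t ->] := cls_surj y.
rewrite /GRing.scale/= /GRing.mul/= !(alg_mulE, alg_scaleE).
exact/clsP/cong_mulA.
Qed.
HB.instance Definition _ := GRing.Lmodule_isLalgebra.Build K alg alg_scaleAl.
Lemma alg_scaleAr a (x y : alg) : a *: (x * y) = x * (a *: y).
Proof.
have [s ->] := cls_surj x; have [t ->] := cls_surj y.
rewrite /GRing.scale/= /GRing.mul/= !(alg_mulE, alg_scaleE).
apply/clsP; apply: (cong_trans (cong_cstC _ _)).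
apply: (cong_trans (cong_sym (cong_mulA _ _ _))).
by apply: cong_mul (cong_refl _) _; apply/cong_sym/cong_cstC.
Qed.
HB.instance Definition _ := GRing.Lalgebra_isAlgebra.Build K alg alg_scaleAr.

Definition gen (x : gens P) : alg := cls (Gen x).

Lemma clsM s t : cls (s * t)%NC = cls s * cls t.
Proof. by rewrite -alg_mulE. Qed.
Lemma clsZ a s : cls (a *: s)%NC = a *: cls s.
Proof. by rewrite -alg_scaleE. Qed.
Lemma cls1 : cls 1%NC = 1.
Proof. by []. Qed.
Lemma clsC a : cls (Cst a) = a%:A.
Proof.
rewrite -cls1 -clsZ; apply/clsP; rewrite -{1}(mulr1 a); exact: cong_cstM.
Qed.
Lemma clsE s : cls s = eval gen s.
Proof.
by elim: s => [x|a|s IHs t IHt|s IHs t IHt] //=; rewrite ?(clsC, clsD, clsM) ?IHs ?IHt.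
Qed.
Lemma gen_rel s t : rels s t -> eval gen s = eval gen t.
Proof. by move=> st; rewrite -!clsE; apply/clsP/cong_rel. Qed.

Section Lift.
Variables (B : algType K) (f : gens P -> B).
Hypothesis fR : forall s t, rels s t -> eval f s = eval f t.

Definition lift (x : alg) : B := let _ := fR in eval f (repr x).

Lemma lift_cls s : lift (cls s) = eval f s.
Proof. exact/(eval_cong fR)/cong_repr. Qed.

Lemma lift_linear : linear lift.
Proof.
move=> a x y; have [s ->] := cls_surj x; have [t ->] := cls_surj y.
by rewrite -clsZ -clsD !lift_cls /= mulr_algl.
Qed.
Lemma lift_monoid_morphism : monoid_morphism lift.
Proof.
split=> [|x y]; first by rewrite -cls1 lift_cls /= scale1r.
have [s ->] := cls_surj x; have [t ->] := cls_surj y.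
by rewrite -clsM !lift_cls.
Qed.
HB.instance Definition _ := GRing.isLinear.Build K alg B *:%R lift lift_linear.
HB.instance Definition _ :=
  GRing.isMonoidMorphism.Build alg B lift lift_monoid_morphism.

Lemma lift_gen x : lift (gen x) = f x.
Proof. by rewrite /gen lift_cls. Qed.
End Lift.

Definition counit : alg -> K^o := lift (@rels_counit _ P).
HB.instance Definition _ := GRing.LRMorphism.on counit.

(* the homogeneous elements of degree n *)
Definition homog (n : int) (x : alg) : Prop :=
  exists2 t, thomog deg n t & x = cls t.

Lemma homog_gen x : homog (deg x) (gen x).
Proof. by exists (Gen x) => //; apply: thomog_gen. Qed.
Lemma homog1 : homog 0 1.
Proof. by exists 1%NC => //; apply: thomog_cst. Qed.
Lemma homogM m n x y : homog m x -> homog n y -> homog (m + n) (x * y).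
Proof.
by move=> [s hs ->] [t ht ->]; exists (s * t)%NC; [apply: thomog_mul|rewrite clsM].
Qed.
Lemma homogD n x y : homog n x -> homog n y -> homog n (x + y).
Proof.
by move=> [s hs ->] [t ht ->]; exists (s + t)%NC; [apply: thomog_add|rewrite clsD].
Qed.
Lemma homogZ n a x : homog n x -> homog n (a *: x).
Proof.
move=> [s hs ->]; exists (a *: s)%NC; last by rewrite clsZ.
by rewrite -[n]add0r; apply: thomog_mul => //; apply: thomog_cst.
Qed.

Lemma homog_ind (Q : alg -> Prop) :
  (forall n x, homog n x -> Q x) -> (forall x y, Q x -> Q y -> Q (x + y)) ->
  forall x, Q x.
Proof.
move=> Qh QD x; have [s ->] := cls_surj x; rewrite clsE.
suff [r [hr ->]] : exists r : seq alg,
    (forall y, y \in r -> exists n, homog n y) /\ eval gen s = \sum_(y <- r) y.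
  elim: r hr => [|y r IH] hr.
    by rewrite big_nil; apply: (Qh 0); exists (Cst 0) => //; apply: thomog_zero.
  rewrite big_cons; apply: QD.
    by have [|n /Qh] := hr y; rewrite ?mem_head.
  by apply: IH => z zr; apply: hr; rewrite inE zr orbT.
elim: s => [y|a|s [r [hr Es]] t [r' [hr' Et]]|s [r [hr Es]] t [r' [hr' Et]]] /=;
  rewrite ?Es ?Et.
- exists [:: gen y]; rewrite big_seq1; split=> // z.
  by rewrite inE => /eqP ->; exists (deg y); apply: homog_gen.
- exists [:: a%:A]; rewrite big_seq1; split=> // z.
  by rewrite inE => /eqP ->; exists 0; apply/homogZ/homog1.
- exists (r ++ r'); rewrite big_cat; split=> // y.
  by rewrite mem_cat => /orP[/hr|/hr'].
- exists [seq y * z | y <- r, z <- r']; split.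
    move=> _ /allpairsP[[y z] /= [/hr [m hy] /hr' [n hz] ->]].
    by exists (m + n); apply: homogM.
  rewrite big_allpairs_dep mulr_suml; apply: eq_bigr => y _.
  by rewrite mulr_sumr.
Qed.

End Alg.

(* * The braiding x \otimes y |-> lam^(|x| |y|) y \otimes x, for x and y
   homogeneous of degrees |x| and |y| (see [braidE]) *)
Section Braid.
Variables (K : fieldType) (lam : K) (lam0 : lam != 0).

Section Dilation.
Variables (P : presentation K) (z : K) (z0 : z != 0).

Definition dil_gen (x : gens P) : alg P := z ^ deg x *: gen x.
Lemma eval_dil n t : thomog deg n t -> eval dil_gen t = z ^ n *: cls t.
Proof.
elim=> {n t} /= [x|a|n|n s t _ -> _ ->|m n s t _ -> _ ->].
- by [].
- by rewrite expr0z scale1r clsC.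
- by rewrite clsC !scale0r scaler0.
- by rewrite clsD scalerDr.
- by rewrite clsM -scalerAl -scalerAr scalerA -expfzDr.
Qed.
Lemma dil_rel s t : rels s t -> eval dil_gen s = eval dil_gen t.
Proof.
move=> st; have [n [hs ht]] := rels_homog st.
by rewrite (eval_dil hs) (eval_dil ht); congr (_ *: _); apply/clsP/cong_rel.
Qed.
(* the algebra automorphism equal to z^n in degree n *)
Definition dil : alg P -> alg P := lift dil_rel.
HB.instance Definition _ := GRing.LRMorphism.on dil.
Lemma dilE n x : homog n x -> dil x = z ^ n *: x.
Proof. by move=> [t ht ->]; rewrite /dil lift_cls (eval_dil ht). Qed.
End Dilation.

Variables P Q : presentation K.

Lemma lam_neq0 (n : int) : lam ^ n != 0. Proof. exact: expfz_neq0. Qed.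

(* y \in alg Q of degree n acts on alg Q \otimes alg P by
   u \otimes x |-> y u \otimes lam^(n |x|) x. *)
Fixpoint braid_act (t : term K (gens Q)) (w : alg Q \ot alg P) :
    alg Q \ot alg P := match t with
  | Gen y => tmap (mull (gen y)) (dil (lam_neq0 (deg y))) w
  | Cst a => a *: w
  | Add s t => braid_act s w + braid_act t w
  | Mul s t => braid_act s (braid_act t w)
  end.

Lemma braid_act_linear t : linear (braid_act t).
Proof.
elim: t => [y|b|s IHs t IHt|s IHs t IHt] a u v /=.
- by rewrite linearP.
- by rewrite scalerDr !scalerA mulrC.
- by rewrite IHs IHt scalerDr addrACA.
- by rewrite IHt IHs.
Qed.

Lemma dil_lam m n x : homog m x -> dil (P := P) (lam_neq0 n) x = lam ^ (m * n) *: x.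
Proof. by move=> hx; rewrite (dilE _ hx) exprz_exp (mulrC m). Qed.

Lemma braid_act_homog m n t u x : thomog deg n t -> homog m x ->
  braid_act t (u \ot x) = lam ^ (m * n) *: ((cls t * u) \ot x).
Proof.
move=> ht hx; elim: ht u => {n t} /= [y|a|n|n s t _ IHs _ IHt|n p s t _ IHs _ IHt] u.
- by rewrite tmapE /= (dil_lam _ hx) pureZr.
- by rewrite mulr0 expr0z scale1r clsC mulr_algl pureZl.
- by rewrite clsC !scale0r mul0r pure0l scaler0.
- by rewrite IHs IHt -scalerDr -pureDl -mulrDl -clsD.
- have lin := braid_act_linear s.
  have actZ a w : braid_act s (a *: w) = a *: braid_act s w.
    have s0 : braid_act s 0 = 0.
      by have := lin (-1) 0 0; rewrite scaler0 addr0 scaleN1r addNr.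
    by have := lin a w 0; rewrite !addr0 s0 addr0.
  by rewrite IHt actZ IHs scalerA mulrA -clsM -expfzDr // -mulrDr (addrC p).
Qed.

Lemma braid_act_cong s t : cong s t -> braid_act s =1 braid_act t.
Proof.
elim=> {s t} /=.
- by [].
- by move=> s t _ IH w.
- by move=> s t r _ IH _ IH' w; rewrite IH IH'.
- by move=> s s' t t' _ IH _ IH' w; rewrite IH IH'.
- by move=> s s' t t' _ IH _ IH' w; rewrite IH IH'.
- by move=> s t r w; rewrite addrA.
- by move=> s t w; rewrite addrC.
- by move=> s w; rewrite scale0r add0r.
- by [].
- by move=> s w; rewrite scale1r.
- by move=> s w; rewrite !scale0r.
- by [].
- move=> s t r w.
  by have := braid_act_linear s 1 (braid_act t w) (braid_act r w); rewrite !scale1r.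
- by move=> a b w; rewrite scalerDl.
- by move=> a b w; rewrite scalerA.
- move=> a s w; have lin := braid_act_linear s.
  have s0 : braid_act s 0 = 0.
    by have := lin (-1) 0 0; rewrite scaler0 addr0 scaleN1r addNr.
  by have := lin a w 0; rewrite !addr0 s0 addr0 => ->.
- move=> s t st w; have [n [hs ht]] := rels_homog st.
  elim/tens_ind: w => [u x|w w' IH IH'].
    elim/homog_ind: x => [m x hx|x x' IH IH'].
      rewrite (braid_act_homog _ hs hx) (braid_act_homog _ ht hx).
      by congr (_ *: ((_ * _) \ot _)); apply/clsP/cong_rel.
    rewrite pureDr.
    have := braid_act_linear s 1 (u \ot x) (u \ot x').
    have := braid_act_linear t 1 (u \ot x) (u \ot x').
    by rewrite !scale1r => -> ->; rewrite IH IH'.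
  have := braid_act_linear s 1 w w'; have := braid_act_linear t 1 w w'.
  by rewrite !scale1r => -> ->; rewrite IH IH'.
Qed.

Definition braid_fun (x : alg P) (y : alg Q) := braid_act (repr y) (1 \ot x).

Lemma braid_fun_cls x t : braid_fun x (cls t) = braid_act t (1 \ot x).
Proof. exact/braid_act_cong/cong_repr. Qed.

Lemma braid_bilinear : bilinear_for *:%R *:%R braid_fun.
Proof.
split=> [y|x] a u v /=.
  by rewrite /braid_fun pureDr pureZr braid_act_linear.
have [s ->] := cls_surj u; have [t ->] := cls_surj v.
by rewrite -clsZ -clsD !braid_fun_cls.
Qed.

Definition braid : alg P \ot alg Q -> alg Q \ot alg P := tlift braid_bilinear.
HB.instance Definition _ := GRing.Linear.on braid.

Lemma braidE m n x y : homog m x -> homog n y ->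
  braid (x \ot y) = lam ^ (m * n) *: (y \ot x).
Proof.
move=> hx [t ht ->]; rewrite /braid tliftE braid_fun_cls.
by rewrite (braid_act_homog _ ht hx) mulr1.
Qed.

End Braid.
Arguments braid {K lam} lam0 P Q x.

(* * The braided tensor square and the braided opposite of a presented algebra *)
Section BraidedAlgebras.
Variables (K : fieldType) (P : presentation K) (lam : K) (lam0 : lam != 0).
Local Notation A := (alg P).
Local Notation Psi := (braid lam0 P P).

(* A \otimes A with (a \otimes b)(c \otimes d) = a Psi(b \otimes c) d *)
Definition btens of lam != 0 : Type := A \ot A.
Local Notation AA := (btens lam0).
HB.instance Definition _ := GRing.Lmodule.copy AA (A \ot A)%type.

Definition btens_mul (x y : A \ot A) : A \ot A :=
  tmap (@tmul K A) (@tmul K A) (tmid Psi (x \ot y)).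

Lemma btens_mulE m n a b c d : homog m b -> homog n c ->
  btens_mul (a \ot b) (c \ot d) = lam ^ (m * n) *: ((a * c) \ot (b * d)).
Proof.
move=> hb hc; rewrite /btens_mul (tmidE _ _ (braidE lam0 hb hc)) linearZ /=.
by rewrite tmapE /= !tmulE.
Qed.

Lemma btens_mulDl : left_distributive btens_mul +%R.
Proof. by move=> x y z; rewrite /btens_mul pureDl !linearD. Qed.
Lemma btens_mulDr : right_distributive btens_mul +%R.
Proof. by move=> x y z; rewrite /btens_mul pureDr !linearD. Qed.
Lemma btens_mulZl a x y : btens_mul (a *: x) y = a *: btens_mul x y.
Proof. by rewrite /btens_mul pureZl !linearZ. Qed.
Lemma btens_mulZr a x y : btens_mul x (a *: y) = a *: btens_mul x y.
Proof. by rewrite /btens_mul pureZr !linearZ. Qed.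

Lemma btens_ind (Q : A \ot A -> Prop) :
  (forall m n a b, homog m a -> homog n b -> Q (a \ot b)) ->
  (forall x y, Q x -> Q y -> Q (x + y)) -> forall x, Q x.
Proof.
move=> Qp QD; elim/tens_ind=> [a b|x y]; last exact: QD.
elim/homog_ind: a => [m a ha|a a' IH IH']; last by rewrite pureDl; apply: QD.
elim/homog_ind: b => [n b hb|b b' IH IH']; last by rewrite pureDr; apply: QD.
exact: Qp ha hb.
Qed.

Lemma btens_mulA : associative btens_mul.
Proof.
move=> x y z.
elim/btens_ind: x => [m n a b ha hb|x x' IH IH']; last first.
  by rewrite !btens_mulDl IH IH'.
elim/btens_ind: y => [p r c d hc hd|y y' IH IH']; last first.
  by rewrite !(btens_mulDl, btens_mulDr) IH IH'.
elim/btens_ind: z => [s t e f he hf|z z' IH IH']; last first.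
  by rewrite !btens_mulDr IH IH'.
rewrite (btens_mulE _ _ hd he) (btens_mulE _ _ hb hc) btens_mulZl btens_mulZr.
rewrite (btens_mulE _ _ hb (homogM hc he)) (btens_mulE _ _ (homogM hb hd) he).
rewrite !scalerA !mulrA -!expfzDr //.
by congr (_ ^ _ *: _); ring.
Qed.
Lemma btens_mul1 : left_id (1 \ot 1) btens_mul.
Proof.
elim/btens_ind=> [m n a b ha hb|x y IH IH']; last by rewrite btens_mulDr IH IH'.
by rewrite (btens_mulE _ _ (homog1 P) ha) mul0r expr0z scale1r !mul1r.
Qed.
Lemma btens_mulr1 : right_id (1 \ot 1) btens_mul.
Proof.
elim/btens_ind=> [m n a b ha hb|x y IH IH']; last by rewrite btens_mulDl IH IH'.
by rewrite (btens_mulE _ _ hb (homog1 P)) mulr0 expr0z scale1r !mulr1.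
Qed.
Lemma btens1_neq0 : 1 \ot 1 != 0 :> A \ot A.
Proof.
apply/eqP => /(congr1 (@tmul K K^o \o tmap (@counit K P) (@counit K P))).
by rewrite linear0 /= tmapE /= tmulE !rmorph1 mulr1 => /eqP; rewrite oner_eq0.
Qed.
HB.instance Definition _ := GRing.Zmodule_isNzRing.Build AA
  btens_mulA btens_mul1 btens_mulr1 btens_mulDl btens_mulDr btens1_neq0.
HB.instance Definition _ := GRing.Lmodule_isLalgebra.Build K AA
  (fun a x y => esym (btens_mulZl a x y)).
HB.instance Definition _ := GRing.Lalgebra_isAlgebra.Build K AA
  (fun a x y => esym (btens_mulZr a x y)).

(* A with the product \cdot Psi(a \otimes b) *)
Definition bopp of lam != 0 : Type := A.
Local Notation Aop := (bopp lam0).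
HB.instance Definition _ := GRing.Lmodule.copy Aop A.

Definition bopp_mul (x y : A) : A := tmul (Psi (x \ot y)).

Lemma bopp_mulE m n x y : homog m x -> homog n y ->
  bopp_mul x y = lam ^ (m * n) *: (y * x).
Proof. by move=> hx hy; rewrite /bopp_mul (braidE lam0 hx hy) linearZ /= tmulE. Qed.

Lemma bopp_mulDl : left_distributive bopp_mul +%R.
Proof. by move=> x y z; rewrite /bopp_mul pureDl !linearD. Qed.
Lemma bopp_mulDr : right_distributive bopp_mul +%R.
Proof. by move=> x y z; rewrite /bopp_mul pureDr !linearD. Qed.
Lemma bopp_mulZl a x y : bopp_mul (a *: x) y = a *: bopp_mul x y.
Proof. by rewrite /bopp_mul pureZl !linearZ. Qed.
Lemma bopp_mulZr a x y : bopp_mul x (a *: y) = a *: bopp_mul x y.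
Proof. by rewrite /bopp_mul pureZr !linearZ. Qed.
Lemma bopp_mulA : associative bopp_mul.
Proof.
move=> x y z.
elim/homog_ind: x => [m x hx|x x' IH IH']; last by rewrite !bopp_mulDl IH IH'.
elim/homog_ind: y => [n y hy|y y' IH IH']; last first.
  by rewrite !(bopp_mulDl, bopp_mulDr) IH IH'.
elim/homog_ind: z => [p z hz|z z' IH IH']; last by rewrite !bopp_mulDr IH IH'.
rewrite (bopp_mulE hy hz) (bopp_mulE hx hy) bopp_mulZl bopp_mulZr.
rewrite (bopp_mulE hx (homogM hz hy)) (bopp_mulE (homogM hy hx) hz).
rewrite !scalerA !mulrA -!expfzDr //.
by congr (_ ^ _ *: _); ring.
Qed.
Lemma bopp_mul1 : left_id 1 bopp_mul.
Proof.
elim/homog_ind=> [n x hx|x y IH IH']; last by rewrite bopp_mulDr IH IH'.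
by rewrite (bopp_mulE (homog1 P) hx) mul0r expr0z scale1r mulr1.
Qed.
Lemma bopp_mulr1 : right_id 1 bopp_mul.
Proof.
elim/homog_ind=> [n x hx|x y IH IH']; last by rewrite bopp_mulDl IH IH'.
by rewrite (bopp_mulE hx (homog1 P)) mulr0 expr0z scale1r mul1r.
Qed.
HB.instance Definition _ := GRing.Zmodule_isNzRing.Build Aop
  bopp_mulA bopp_mul1 bopp_mulr1 bopp_mulDl bopp_mulDr (oner_neq0 A).
HB.instance Definition _ := GRing.Lmodule_isLalgebra.Build K Aop
  (fun a x y => esym (bopp_mulZl a x y)).
HB.instance Definition _ := GRing.Lalgebra_isAlgebra.Build K Aop
  (fun a x y => esym (bopp_mulZr a x y)).

End BraidedAlgebras.

Local Open Scope complex_scope.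

(* Equality of two linear combinations of the same vectors, by comparing
   coefficients. *)
Section LinearCombinations.
Variables (K : fieldType) (V : lmodType K).
Inductive lexp :=
  | LAtom of nat | LZero | LAdd of lexp & lexp | LOpp of lexp
  | LScale of K & lexp.
Fixpoint leval (s : seq V) e := match e with
  | LAtom n => s`_n
  | LZero => 0
  | LAdd e f => leval s e + leval s f
  | LOpp e => - leval s e
  | LScale a e => a *: leval s e
  end.
Fixpoint lcoef e (i : nat) : K := match e with
  | LAtom n => if (i == n)%N then 1 else 0
  | LZero => 0
  | LAdd e f => lcoef e i + lcoef f i
  | LOpp e => - lcoef e i
  | LScale a e => a * lcoef e i
  end.
Lemma leval_coef s e : leval s e = \sum_(i < size s) lcoef e i *: s`_i.
Proof.
elim: e => [n||e IHe f IHf|e IHe|a e IHe] /=; rewrite ?IHe ?IHf.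
- have [ns|sn] := ltnP n (size s).
    rewrite (bigD1 (Ordinal ns)) //= eqxx scale1r big1 ?addr0 // => i.
    by rewrite -val_eqE /= => /negPf ->; rewrite scale0r.
  rewrite nth_default // big1 // => i _.
  by rewrite ltn_eqF ?scale0r // (leq_trans (ltn_ord i)).
- by rewrite big1 // => i _; rewrite scale0r.
- by rewrite -big_split; apply: eq_bigr => i _; rewrite scalerDl.
- by rewrite -sumrN; apply: eq_bigr => i _; rewrite scaleNr.
- by rewrite scaler_sumr; apply: eq_bigr => i _; rewrite scalerA.
Qed.
Lemma lexpP s e f :
  foldr (fun i Q => lcoef e i = lcoef f i /\ Q) True (iota 0 (size s)) ->
  leval s e = leval s f.
Proof.
move=> ef; rewrite !leval_coef; apply: eq_bigr => i _; congr (_ *: _).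
have: (i : nat) \in iota 0 (size s) by rewrite mem_iota /=.
by elim: (iota _ _) ef => //= j r IH [ej er]; rewrite inE => /predU1P[->|/IH]; auto.
Qed.
End LinearCombinations.

Ltac lc_index x s := lazymatch s with
  | ?y :: ?s' => match constr:(Set) with
     | _ => let _ := lazymatch x with y => constr:(Set) end in constr:(0%N)
     | _ => let n := lc_index x s' in constr:(S n)
     end
  end.
Ltac lc_atoms V s e := lazymatch e with
  | (?x + ?y)%R => let s' := lc_atoms V s x in lc_atoms V s' y
  | (- ?x)%R => lc_atoms V s x
  | (_ *: ?x)%R => lc_atoms V s x
  | 0%R => s
  | _ => match constr:(Set) with
     | _ => let _ := lc_index e s in s
     | _ => constr:(@cons V e s)
     end
  end.
Ltac lc_reify K s e := lazymatch e with
  | (?x + ?y)%R => let x' := lc_reify K s x in let y' := lc_reify K s y in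
      constr:(@LAdd K x' y')
  | (- ?x)%R => let x' := lc_reify K s x in constr:(@LOpp K x')
  | (?a *: ?x)%R => let x' := lc_reify K s x in constr:(@LScale K a x')
  | 0%R => constr:(@LZero K)
  | _ => let n := lc_index e s in constr:(@LAtom K n)
  end.
Tactic Notation "lincomb" constr(K) constr(V) := lazymatch goal with |- ?e = ?f =>
  let s := lc_atoms V (@nil V) e in let s := lc_atoms V s f in
  let e' := lc_reify K s e in let f' := lc_reify K s f in
  refine (@lexpP K V s e' f' _); rewrite /=; repeat split end.

Lemma thomog_mul_eq (K : fieldType) X (deg : X -> int) m n p (s t : term K X) :
  thomog deg m s -> thomog deg n t -> p = m + n -> thomog deg p (s * t)%NC.
Proof. by move=> hs ht ->; apply: thomog_mul. Qed.

Ltac homogeneous n := exists n; split;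
  repeat first
   [ apply: thomog_gen | apply: thomog_cst | apply: thomog_zero
   | apply: thomog_add | eapply thomog_mul_eq | reflexivity ].

(* e^(ix) *)
Definition expi (R : realType) (x : R) : R[i] := cos x +i* sin x.

Lemma expiD (R : realType) (x y : R) : expi (x + y) = expi x * expi y.
Proof.
rewrite /expi sinD cosD; simpc.
by congr (_ +i* _); ring.
Qed.
Lemma expi0 (R : realType) : expi (0 : R) = 1.
Proof. by rewrite /expi cos0 sin0. Qed.
Lemma expi_neq0 (R : realType) (x : R) : expi x != 0.
Proof.
apply/eqP => x0; have := expiD x (- x).
by rewrite subrr expi0 x0 mul0r => /eqP; rewrite oner_eq0.
Qed.
Lemma expiN (R : realType) (x : R) : expi (- x) = (expi x)^-1.
Proof.
by apply: (mulfI (expi_neq0 x)); rewrite -expiD subrr expi0 mulfV ?expi_neq0.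
Qed.

(* The braidings are lam^(|x| |y|) = e^(2i phi |x| |y|). *)
Definition lam (R : realType) (phi : R) : R[i] := expi (2 * phi).
Lemma lam_unit (R : realType) (phi : R) : lam phi != 0.
Proof. exact: expi_neq0. Qed.
Lemma expi4 (R : realType) (phi : R) : expi (4 * phi) = lam phi ^+ 2.
Proof. by rewrite expr2 -expiD; congr expi; ring. Qed.
Lemma expiN4 (R : realType) (phi : R) : expi (- 4 * phi) = lam phi ^- 2.
Proof. by rewrite mulNr expiN expi4. Qed.

(* * The braided Hopf algebra SU_(q, phi)(2) *)

Inductive su_gens := su_alpha | su_gamma | su_alphas | su_gammas.
Definition su_deg (x : su_gens) : int :=
  match x with su_alpha | su_alphas => 0 | su_gamma => - 2 | su_gammas => 2 end.

Section SU.
Variables (R : realType) (q phi : R).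
Local Notation C := R[i].
Local Notation "'e^' x" := (expi (x * phi)%R) (at level 8, x at level 2).
Local Notation qC := (real_complex R q).

Section Relations.
Local Open Scope nc_scope.
Local Notation al := (@Gen C su_gens su_alpha).
Local Notation ga := (@Gen C su_gens su_gamma).
Local Notation als := (@Gen C su_gens su_alphas).
Local Notation gas := (@Gen C su_gens su_gammas).

Inductive su_rels : term C su_gens -> term C su_gens -> Prop :=
  | su_rel1 : su_rels (al * ga) (qC * e^4 *: (ga * al))
  | su_rel2 : su_rels (al * gas) (qC * e^(-4) *: (gas * al))
  | su_rel3 : su_rels (ga * als) (qC * e^4 *: (als * ga))
  | su_rel4 : su_rels (gas * als) (qC * e^(-4) *: (als * gas))
  | su_rel5 : su_rels (al * als + qC ^+ 2 *: (gas * ga)) 1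
  | su_rel6 : su_rels (als * al + ga * gas) 1
  | su_rel7 : su_rels (ga * gas) (gas * ga).
End Relations.

Definition su_counit (x : su_gens) : C^o :=
  match x with su_alpha | su_alphas => 1 | su_gamma | su_gammas => 0 end.

Lemma su_rels_homog s t : su_rels s t ->
  exists n, thomog su_deg n s /\ thomog su_deg n t.
Proof.
case.
- homogeneous (-2 : int).
- homogeneous (2 : int).
- homogeneous (-2 : int).
- homogeneous (2 : int).
- homogeneous (0 : int).
- homogeneous (0 : int).
- homogeneous (0 : int).
Qed.

Lemma su_rels_counit s t : su_rels s t ->
  eval su_counit s = eval su_counit t.
Proof.
by case => /=; rewrite ?(mul0r, mulr0, scaler0, addr0, mulr1, mulr_algl, scale1r).
Qed.

Definition SU : presentation C := Presentation su_rels_homog su_rels_counit.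

End SU.

Section SUHopf.
Variables (R : realType) (q phi : R) (q01 : 0 < q < 1).
Local Notation C := R[i].
Local Notation "'e^' x" := (expi (x * phi)%R) (at level 8, x at level 2).
Local Notation qC := (real_complex R q).
Local Notation A := (alg (SU q phi)).
Local Notation lam0 := (lam_unit phi).
Local Notation al := (@gen C (SU q phi) su_alpha).
Local Notation ga := (@gen C (SU q phi) su_gamma).
Local Notation als := (@gen C (SU q phi) su_alphas).
Local Notation gas := (@gen C (SU q phi) su_gammas).

Definition su_Delta_gen (x : su_gens) : btens (SU q phi) lam0 :=
  match x with
  | su_alpha => al \ot al - (qC * e^(-4)) *: (gas \ot ga)
  | su_gamma => ga \ot al + als \ot ga
  | su_alphas => als \ot als - (qC * e^(-4)) *: (ga \ot gas)
  | su_gammas => gas \ot als + al \ot gas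
  end.

Definition su_S_gen (x : su_gens) : bopp (SU q phi) lam0 :=
  match x with
  | su_alpha => als
  | su_gamma => - (qC * e^4) *: ga
  | su_alphas => al
  | su_gammas => - (qC^-1 * e^4) *: gas
  end.

Let q0 : qC != 0.
Proof.
by have /andP[+ _] := q01; rewrite lt0r eq_complex /= => /andP[/negPf -> _].
Qed.

Let l0 := lam_unit phi.

Lemma su_agE : al * ga = (qC * lam phi ^+ 2) *: (ga * al).
Proof. by have /= := gen_rel (P := SU q phi) (su_rel1 q phi); rewrite mulr_algl expi4. Qed.
Lemma su_agsE : al * gas = (qC * lam phi ^- 2) *: (gas * al).
Proof. by have /= := gen_rel (P := SU q phi) (su_rel2 q phi); rewrite mulr_algl expiN4. Qed.
Lemma su_asgE : als * ga = (qC * lam phi ^+ 2)^-1 *: (ga * als).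
Proof.
have /= := gen_rel (P := SU q phi) (su_rel3 q phi); rewrite mulr_algl expi4 => ->.
by rewrite scalerA mulVf ?scale1r // mulf_neq0 ?expf_neq0.
Qed.
Lemma su_asgsE : als * gas = (qC * lam phi ^- 2)^-1 *: (gas * als).
Proof.
have /= := gen_rel (P := SU q phi) (su_rel4 q phi); rewrite mulr_algl expiN4 => ->.
by rewrite scalerA mulVf ?scale1r // mulf_neq0 ?invr_neq0 ?expf_neq0.
Qed.
Lemma su_ggsE : ga * gas = gas * ga.
Proof. exact: (gen_rel (P := SU q phi) (su_rel7 q phi)). Qed.
Definition su_one : A := 1.
Lemma su_aasE : al * als = su_one - qC ^+ 2 *: (gas * ga).
Proof.
have /= := gen_rel (P := SU q phi) (su_rel5 q phi); rewrite mulr_algl scale1r /su_one => <-.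
by rewrite addrK.
Qed.
Lemma su_asaE : als * al = su_one - gas * ga.
Proof.
have /= := gen_rel (P := SU q phi) (su_rel6 q phi); rewrite scale1r su_ggsE /su_one => <-.
by rewrite addrK.
Qed.

Let su_nf := (su_agE, su_agsE, su_asgE, su_asgsE, su_ggsE, su_aasE, su_asaE).

Local Notation g := (@gen C (SU q phi)).
Let su_mulE (x y z t : su_gens) :
  (g x \ot g y : btens (SU q phi) lam0) * (g z \ot g t) =
  lam phi ^ (su_deg y * su_deg z) *: ((g x * g z) \ot (g y * g t)).
Proof. exact: (btens_mulE lam0 _ _ (homog_gen _) (homog_gen _)). Qed.

Let btens1E : (1 : btens (SU q phi) lam0) = su_one \ot su_one.
Proof. by []. Qed.

Let twE := (mul0r, mulr0, expr0z, scale1r,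
  erefl : lam phi ^ (-2 * -2) = lam phi ^+ 4,
  erefl : lam phi ^ (2 * 2) = lam phi ^+ 4,
  erefl : lam phi ^ (-2 * 2) = lam phi ^- 4,
  erefl : lam phi ^ (2 * -2) = lam phi ^- 4).

Let su_oppE (x y : su_gens) : (g x : bopp (SU q phi) lam0) * g y =
  lam phi ^ (su_deg x * su_deg y) *: (g y * g x).
Proof. exact: (bopp_mulE lam0 (homog_gen _) (homog_gen _)). Qed.
Let bopp1E : (1 : bopp (SU q phi) lam0) = su_one.
Proof. by []. Qed.

Lemma su_Delta_rel s t : su_rels q phi s t ->
  eval su_Delta_gen s = eval su_Delta_gen t.
Proof.
case=> /=; rewrite ?mulr_algl ?(expi4, expiN4);
  rewrite ?(mulrDl, mulrDr, mulrN, mulNr) -?(scalerAl, scalerAr);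
  rewrite !su_mulE ?su_nf ?(pureDl, pureDr, pureNl, pureNr, pureZl, pureZr);
  rewrite /= ?twE ?btens1E; lincomb C (A \ot A)%type; field; by rewrite ?l0 ?q0.
Qed.

Lemma su_S_rel s t : su_rels q phi s t -> eval su_S_gen s = eval su_S_gen t.
Proof.
case=> /=; rewrite ?mulr_algl ?(expi4, expiN4);
  rewrite ?(mulrDl, mulrDr, mulrN, mulNr) -?(scalerAl, scalerAr);
  rewrite ?su_oppE ?su_nf /= ?twE ?bopp1E;
  lincomb C A; field; by rewrite ?l0 ?q0.
Qed.

(* The algebra homomorphism into the braided tensor square, and the algebra
   homomorphism into the braided opposite: S(xy) = \cdot Psi(S x \otimes S y). *)
Definition su_Delta : A -> A \ot A := lift (P := SU q phi) su_Delta_rel.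
HB.instance Definition _ :=
  GRing.isLinear.Build C A (A \ot A)%type *:%R su_Delta 
    (lift_linear (P := SU q phi) su_Delta_rel).

Definition su_S : A -> A := lift (P := SU q phi) su_S_rel.
HB.instance Definition _ :=
  GRing.isLinear.Build C A A *:%R su_S 
    (lift_linear (P := SU q phi) su_S_rel).

End SUHopf.
Arguments su_Delta {R q} phi q01 x.
Arguments su_S {R q} phi q01 x.

(* * The braided Hopf algebra U_(q, phi)(u(2)^) *)

(* u_ks is k^*, u_ki and u_ksi are the inverses of k and k^* *)
Inductive u_gens := u_e | u_f | u_k | u_ks | u_ki | u_ksi.
Definition u_deg (x : u_gens) : int :=
  match x with u_e => - 2 | u_f => 2 | _ => 0 end.

Section U.
Variables (R : realType) (q phi : R).
Local Notation C := R[i].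
Local Notation "'e^' x" := (expi (x * phi)%R) (at level 8, x at level 2).
Local Notation qC := (real_complex R q).

Section Relations.
Local Open Scope nc_scope.
Local Notation e := (@Gen C u_gens u_e).
Local Notation f := (@Gen C u_gens u_f).
Local Notation k := (@Gen C u_gens u_k).
Local Notation ks := (@Gen C u_gens u_ks).
Local Notation ki := (@Gen C u_gens u_ki).
Local Notation ksi := (@Gen C u_gens u_ksi).

Inductive u_rels : term C u_gens -> term C u_gens -> Prop :=
  | u_rel1 : u_rels (e * k) (qC * e^(-4) *: (k * e))
  | u_rel2 : u_rels (k * f) (qC * e^(-4) *: (f * k))
  | u_rel3 : u_rels (ks * f) (qC * e^4 *: (f * ks))
  | u_rel4 : u_rels (e * ks) (qC * e^4 *: (ks * e))
  | u_rel5 : u_rels (k * ks) (ks * k)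
  | u_rel6 : u_rels (e * f - f * e) ((qC^-1 - qC)^-1 *: (k * ks - ki * ksi))
  | u_rel_k_ki : u_rels (k * ki) 1
  | u_rel_ki_k : u_rels (ki * k) 1
  | u_rel_ks_ksi : u_rels (ks * ksi) 1
  | u_rel_ksi_ks : u_rels (ksi * ks) 1.
End Relations.

Definition u_counit (x : u_gens) : C^o :=
  match x with u_e | u_f => 0 | u_k | u_ks | u_ki | u_ksi => 1 end.

Lemma u_rels_homog s t : u_rels s t ->
  exists n, thomog u_deg n s /\ thomog u_deg n t.
Proof.
case.
- homogeneous (-2 : int).
- homogeneous (2 : int).
- homogeneous (2 : int).
- homogeneous (-2 : int).
- homogeneous (0 : int).
- homogeneous (0 : int).
- homogeneous (0 : int).
- homogeneous (0 : int).
- homogeneous (0 : int).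
- homogeneous (0 : int).
Qed.

Lemma u_rels_counit s t : u_rels s t ->
  eval u_counit s = eval u_counit t.
Proof.
by case => /=; rewrite ?(mul0r, mulr0, scaler0, addr0, mulr1, mulr_algl,
  scale1r, scaleN1r, subrr).
Qed.

Definition Uhat : presentation C := Presentation u_rels_homog u_rels_counit.

End U.

Section UHopf.
Variables (R : realType) (q phi : R) (q01 : 0 < q < 1).
Local Notation C := R[i].
Local Notation "'e^' x" := (expi (x * phi)%R) (at level 8, x at level 2).
Local Notation qC := (real_complex R q).
Local Notation H := (alg (Uhat q phi)).
Local Notation lam0 := (lam_unit phi).
Local Notation e := (@gen C (Uhat q phi) u_e).
Local Notation f := (@gen C (Uhat q phi) u_f).
Local Notation k := (@gen C (Uhat q phi) u_k).
Local Notation ks := (@gen C (Uhat q phi) u_ks).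
Local Notation ki := (@gen C (Uhat q phi) u_ki).
Local Notation ksi := (@gen C (Uhat q phi) u_ksi).

Definition u_Delta_gen (x : u_gens) : btens (Uhat q phi) lam0 :=
  match x with
  | u_e => e \ot k + ki \ot e
  | u_f => f \ot ks + ksi \ot f
  | u_k => k \ot k
  | u_ks => ks \ot ks
  | u_ki => ki \ot ki
  | u_ksi => ksi \ot ksi
  end.

Definition u_S_gen (x : u_gens) : bopp (Uhat q phi) lam0 :=
  match x with
  | u_e => - (qC^-1 * e^4) *: e
  | u_f => - (qC * e^4) *: f
  | u_k => ki
  | u_ks => ksi
  | u_ki => k
  | u_ksi => ks
  end.

Let q0 : qC != 0.
Proof.
by have /andP[+ _] := q01; rewrite lt0r eq_complex /= => /andP[/negPf -> _].
Qed.
Let l0 := lam_unit phi.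
Let ql4 : qC * lam phi ^+ 2 != 0. Proof. by rewrite mulf_neq0 ?expf_neq0. Qed.
Let qlN4 : qC * lam phi ^- 2 != 0.
Proof. by rewrite mulf_neq0 ?invr_neq0 ?expf_neq0. Qed.

Lemma comm_inv (B : algType C) (x y yi : B) c : y * yi = 1 -> yi * y = 1 ->
  c != 0 -> x * y = c *: (y * x) -> x * yi = c^-1 *: (yi * x).
Proof.
move=> yyi yiy c0 xy; apply: (scalerI c0); rewrite scalerA divff // scale1r.
have -> : yi * x = yi * (x * y) * yi by rewrite -!mulrA yyi mulr1.
by rewrite xy -scalerAr -scalerAl !mulrA yiy mul1r.
Qed.

Definition u_one : H := 1.
Lemma u_kkiE : k * ki = u_one.
Proof. by have /= := gen_rel (P := Uhat q phi) (u_rel_k_ki q phi); rewrite scale1r. Qed.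
Lemma u_kikE : ki * k = u_one.
Proof. by have /= := gen_rel (P := Uhat q phi) (u_rel_ki_k q phi); rewrite scale1r. Qed.
Lemma u_ksksiE : ks * ksi = u_one.
Proof. by have /= := gen_rel (P := Uhat q phi) (u_rel_ks_ksi q phi); rewrite scale1r. Qed.
Lemma u_ksiksE : ksi * ks = u_one.
Proof. by have /= := gen_rel (P := Uhat q phi) (u_rel_ksi_ks q phi); rewrite scale1r. Qed.
Lemma u_ekE : e * k = (qC * lam phi ^- 2) *: (k * e).
Proof.
by have /= := gen_rel (P := Uhat q phi) (u_rel1 q phi); rewrite mulr_algl expiN4.
Qed.
Lemma u_fkE : f * k = (qC * lam phi ^- 2)^-1 *: (k * f).
Proof.
have /= := gen_rel (P := Uhat q phi) (u_rel2 q phi); rewrite mulr_algl expiN4 => ->.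
by rewrite scalerA mulVf ?scale1r.
Qed.
Lemma u_fksE : f * ks = (qC * lam phi ^+ 2)^-1 *: (ks * f).
Proof.
have /= := gen_rel (P := Uhat q phi) (u_rel3 q phi); rewrite mulr_algl expi4 => ->.
by rewrite scalerA mulVf ?scale1r.
Qed.
Lemma u_eksE : e * ks = (qC * lam phi ^+ 2) *: (ks * e).
Proof.
by have /= := gen_rel (P := Uhat q phi) (u_rel4 q phi); rewrite mulr_algl expi4.
Qed.
Lemma u_kskE : ks * k = k * ks.
Proof. exact/esym/(gen_rel (P := Uhat q phi) (u_rel5 q phi)). Qed.
Lemma u_efE : e * f = f * e + (qC^-1 - qC)^-1 *: (k * ks - ki * ksi).
Proof.
have /= := gen_rel (P := Uhat q phi) (u_rel6 q phi).
by rewrite !mulr_algl !scaleN1r => <-; rewrite addrC subrK.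
Qed.
Lemma u_ekiE : e * ki = (qC * lam phi ^- 2)^-1 *: (ki * e).
Proof. exact: comm_inv u_kkiE u_kikE qlN4 u_ekE. Qed.
Lemma u_fkiE : f * ki = (qC * lam phi ^- 2) *: (ki * f).
Proof.
rewrite -[X in X *: _]invrK.
by apply: comm_inv u_kkiE u_kikE _ u_fkE; rewrite invr_eq0.
Qed.
Lemma u_eksiE : e * ksi = (qC * lam phi ^+ 2)^-1 *: (ksi * e).
Proof. exact: comm_inv u_ksksiE u_ksiksE ql4 u_eksE. Qed.
Lemma u_fksiE : f * ksi = (qC * lam phi ^+ 2) *: (ksi * f).
Proof.
rewrite -[X in X *: _]invrK.
by apply: comm_inv u_ksksiE u_ksiksE _ u_fksE; rewrite invr_eq0.
Qed.
Lemma u_kskiE : ks * ki = ki * ks.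
Proof.
rewrite -[RHS]scale1r -invr1; apply: comm_inv u_kkiE u_kikE (oner_neq0 _) _.
by rewrite scale1r u_kskE.
Qed.
Lemma u_ksikE : ksi * k = k * ksi.
Proof.
apply: esym; rewrite -[RHS]scale1r -invr1.
by apply: comm_inv u_ksksiE u_ksiksE (oner_neq0 _) _; rewrite scale1r u_kskE.
Qed.
Lemma u_ksikiE : ksi * ki = ki * ksi.
Proof.
rewrite -[RHS]scale1r -invr1; apply: comm_inv u_kkiE u_kikE (oner_neq0 _) _.
by rewrite scale1r u_ksikE.
Qed.

Let u_nf := (u_kkiE, u_kikE, u_ksksiE, u_ksiksE, u_ekE, u_fkE, u_fksE, u_eksE,
  u_kskE, u_efE, u_ekiE, u_fkiE, u_eksiE, u_fksiE, u_kskiE, u_ksikE, u_ksikiE).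

Local Notation g := (@gen C (Uhat q phi)).
Let u_mulE (x y z t : u_gens) :
  (g x \ot g y : btens (Uhat q phi) lam0) * (g z \ot g t) =
  lam phi ^ (u_deg y * u_deg z) *: ((g x * g z) \ot (g y * g t)).
Proof. exact: (btens_mulE lam0 _ _ (homog_gen _) (homog_gen _)). Qed.
Let btens1E : (1 : btens (Uhat q phi) lam0) = u_one \ot u_one.
Proof. by []. Qed.

Let twE := (mul0r, mulr0, expr0z, scale1r, scaleN1r,
  erefl : lam phi ^ (-2 * -2) = lam phi ^+ 4,
  erefl : lam phi ^ (2 * 2) = lam phi ^+ 4,
  erefl : lam phi ^ (-2 * 2) = lam phi ^- 4,
  erefl : lam phi ^ (2 * -2) = lam phi ^- 4).

Let u_oppE (x y : u_gens) : (g x : bopp (Uhat q phi) lam0) * g y =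
  lam phi ^ (u_deg x * u_deg y) *: (g y * g x).
Proof. exact: (bopp_mulE lam0 (homog_gen _) (homog_gen _)). Qed.
Let bopp1E : (1 : bopp (Uhat q phi) lam0) = u_one.
Proof. by []. Qed.

Lemma u_Delta_rel s t : u_rels q phi s t ->
  eval u_Delta_gen s = eval u_Delta_gen t.
Proof.
case=> /=; rewrite ?mulr_algl ?(expi4, expiN4) ?scaleN1r;
  rewrite ?(mulrDl, mulrDr, mulrN, mulNr) -?(scalerAl, scalerAr);
  rewrite !u_mulE ?u_nf ?(pureDl, pureDr, pureNl, pureNr, pureZl, pureZr);
  rewrite /= ?twE ?btens1E; lincomb C (H \ot H)%type;
  move: (qC^-1 - qC)^-1 => w; field; by rewrite ?l0 ?q0.
Qed.

Lemma u_S_rel s t : u_rels q phi s t -> eval u_S_gen s = eval u_S_gen t.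
Proof.
case=> /=; rewrite ?mulr_algl ?(expi4, expiN4) ?scaleN1r;
  rewrite ?(mulrDl, mulrDr, mulrN, mulNr) -?(scalerAl, scalerAr);
  rewrite ?u_oppE ?u_nf /= ?twE ?bopp1E; lincomb C H;
  move: (qC^-1 - qC)^-1 => w; field; by rewrite ?l0 ?q0.
Qed.

Definition u_Delta : H -> H \ot H := lift (P := Uhat q phi) u_Delta_rel.
HB.instance Definition _ :=
  GRing.isLinear.Build C H (H \ot H)%type *:%R u_Delta
    (lift_linear (P := Uhat q phi) u_Delta_rel).

Definition u_S : H -> H := lift (P := Uhat q phi) u_S_rel.
HB.instance Definition _ :=
  GRing.isLinear.Build C H H *:%R u_S
    (lift_linear (P := Uhat q phi) u_S_rel).

End UHopf.
Arguments u_Delta {R q} phi q01 x.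
Arguments u_S {R q} phi q01 x.

(* * Braided pairings *)
Section Pairing.
Variables (K : fieldType) (H A : algType K).
Local Notation id_ V := (@idfun V).

Section Def.
Variables (DeltaH : {linear H -> (H \ot H)%type}) (SH : {linear H -> H})
  (epsH : {linear H -> K^o}).
Variables (DeltaA : {linear A -> (A \ot A)%type}) (SA : {linear A -> A})
  (epsA : {linear A -> K^o}).
Variables (Xi : {linear (H \ot A)%type -> (A \ot H)%type})
  (p : {linear (H \ot A)%type -> K^o}).

Definition pair2 : H \ot A \ot (H \ot A) -> K^o := @tmul K K^o \o tmap p p.

Record compatible_braiding : Prop := {
  Xi_bij : bijective Xi;
  Xi_mulH : Xi \o tmap (@tmul K H) (id_ A) =1
    tmap (id_ A) (@tmul K H) \o @tassoc K A H H \o tmap Xi (id_ H)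
      \o @tunassoc K H A H \o tmap (id_ H) Xi \o @tassoc K H H A;
  Xi_mulA : Xi \o tmap (id_ H) (@tmul K A) =1
    tmap (@tmul K A) (id_ H) \o @tunassoc K A A H \o tmap (id_ A) Xi
      \o @tassoc K A H A \o tmap Xi (id_ A) \o @tunassoc K H A A;
  Xi_DeltaH : tmap (id_ A) DeltaH \o Xi =1
    @tassoc K A H H \o tmap Xi (id_ H) \o @tunassoc K H A H
      \o tmap (id_ H) Xi \o @tassoc K H H A \o tmap DeltaH (id_ A);
  Xi_DeltaA : tmap DeltaA (id_ H) \o Xi =1
    @tunassoc K A A H \o tmap (id_ A) Xi \o @tassoc K A H A
      \o tmap Xi (id_ A) \o @tunassoc K H A A \o tmap (id_ H) DeltaA
}.

Record braided_pairing : Prop := {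
  pairing_Xi : compatible_braiding;
  pairing_mulA : p \o tmap (id_ H) (@tmul K A) =1
    pair2 \o tmid Xi \o tmap DeltaH (id_ (A \ot A)%type);
  pairing_mulH : p \o tmap (@tmul K H) (id_ A) =1
    pair2 \o tmid Xi \o tmap (id_ (H \ot H)%type) DeltaA;
  pairing_S : forall h a, p (SH h \ot a) = p (h \ot SA a);
  pairing_1A : forall a, p (1 \ot a) = epsA a;
  pairing_1H : forall h, p (h \ot 1) = epsH h
}.
End Def.

(* Compatibility of a pairing with braidings of A and of H: the identities
   (id \otimes p)(Xi \otimes id)(id \otimes PsiA) = p \otimes id on
   H \otimes A \otimes A, and (p \otimes id)(id \otimes Xi)(PsiH \otimes id) =
   id \otimes p on H \otimes H \otimes A, with K \otimes V = V = V \otimes K. *)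
Variables (PsiH : {linear (H \ot H)%type -> (H \ot H)%type})
  (PsiA : {linear (A \ot A)%type -> (A \ot A)%type})
  (Xi : {linear (H \ot A)%type -> (A \ot H)%type})
  (p : {linear (H \ot A)%type -> K^o}).

Definition pairing_slideA : Prop :=
  @runit K A \o tmap (id_ A) p \o @tassoc K A H A \o tmap Xi (id_ A)
    \o @tunassoc K H A A \o tmap (id_ H) PsiA =1
  @lunit K A \o tmap p (id_ A) \o @tunassoc K H A A.

Definition pairing_slideH : Prop :=
  @lunit K H \o tmap p (id_ H) \o @tunassoc K H A H \o tmap (id_ H) Xi
    \o @tassoc K H H A \o tmap PsiH (id_ A) =1
  @runit K H \o tmap (id_ H) p \o @tassoc K H H A.

End Pairing.

Section Values.
Variables (R : realType) (q phi : R).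

Definition su_Psi := braid (lam_unit phi) (SU q phi) (SU q phi).
HB.instance Definition _ := GRing.Linear.on su_Psi.
Definition u_Psi := braid (lam_unit phi) (Uhat q phi) (Uhat q phi).
HB.instance Definition _ := GRing.Linear.on u_Psi.
Definition Xi := braid (lam_unit phi) (Uhat q phi) (SU q phi).
HB.instance Definition _ := GRing.Linear.on Xi.

Local Notation "'e^' x" := (expi (x * phi)%R) (at level 8, x at level 2).

Definition pairing_gen (x : u_gens) (y : su_gens) : R[i] :=
  let qC := q%:C in let rq := (Num.sqrt q)%:C in
  match x, y with
  | u_e, su_gammas => - qC^-1 * e^(-4)
  | u_f, su_gamma => 1
  | u_k, su_alpha => rq^-1 * e^2
  | u_k, su_alphas => rq * e^(-2)
  | u_ks, su_alpha => rq^-1 * e^(-2)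
  | u_ks, su_alphas => rq * e^2
  | u_ki, su_alpha => rq * e^(-2)
  | u_ki, su_alphas => rq^-1 * e^2
  | u_ksi, su_alpha => rq * e^2
  | u_ksi, su_alphas => rq^-1 * e^(-2)
  | _, _ => 0
  end.
End Values.
Arguments su_Psi {R} q phi x.
Arguments u_Psi {R} q phi x.
Arguments Xi {R} q phi x.

(* Main.v *)
Require Import Defs.
From HB Require Import structures.
From mathcomp Require Import all_boot all_order all_algebra.
From mathcomp Require Import complex.
From mathcomp Require Import boolp reals trigo.
From mathcomp Require Import ring.

Set Implicit Arguments.
Unset Strict Implicit.
Unset Printing Implicit Defensive.

Import Order.TTheory GRing.Theory Num.Theory.
Local Open Scope ring_scope.
Local Open Scope complex_scope.

(* Instead of the pairing one constructs the left action of H on A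
     h |> a = sum lam^(|h| |a1|) <h, a2> a1
   and recovers <h, a> = eps (h |> a).  The braided factor is chosen so that
   this is an honest action of the algebra H, while the generators act on
   products by h |> (a b) = sum lam^(|h2| |a|) (h1 |> a) (h2 |> b): the
   generators k, k^* act by diagonal automorphisms of A and e, f by skew
   derivations, which are algebra maps from A to upper triangular matrices over
   A.  The product rule for general h is the first pairing axiom; the second
   one says that the action commutes with the left coaction,
     Delta (h |> a) = sum lam^(|h| |a1|) a1 (x) (h |> a2),
   which holds on the span of the generators of A and passes to products by the
   product rule.  The action is graded and eps vanishes outside degree 0, so
   <h, a> = 0 unless |h| = - |a|; this gives the two sliding identities and
   makes the braiding factors cancel in the antipode axiom. *)

(** * Representations of presented algebras *)

Section Representation.
Variables (K : fieldType) (P : presentation K) (V : lmodType K).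
Variable op : gens P -> {linear V -> V}.

Fixpoint term_act (t : term K (gens P)) (v : V) : V := match t with
  | Gen x => op x v
  | Cst a => a *: v
  | Add s t => term_act s v + term_act t v
  | Mul s t => term_act s (term_act t v)
  end.

Lemma term_act_linear t : linear (term_act t).
Proof.
elim: t => [y|b|s IHs t IHt|s IHs t IHt] a u v /=.
- by rewrite linearP.
- by rewrite scalerDr !scalerA mulrC.
- by rewrite IHs IHt scalerDr addrACA.
- by rewrite IHt IHs.
Qed.
HB.instance Definition _ t :=
  GRing.isLinear.Build K V V *:%R (term_act t) (term_act_linear t).

Hypothesis opR : forall s t, rels s t -> term_act s =1 term_act t.

Lemma term_act_cong s t : cong s t -> term_act s =1 term_act t.
Proof.
elim=> {s t} /=.
- by [].
- by move=> s t _ IH w.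
- by move=> s t r _ IH _ IH' w; rewrite IH IH'.
- by move=> s s' t t' _ IH _ IH' w; rewrite IH IH'.
- by move=> s s' t t' _ IH _ IH' w; rewrite IH IH'.
- by move=> s t r w; rewrite addrA.
- by move=> s t w; rewrite addrC.
- by move=> s w; rewrite scale0r add0r.
- by [].
- by move=> s w; rewrite scale1r.
- by move=> s w; rewrite !scale0r.
- by [].
- by move=> s t r w; rewrite linearD.
- by move=> a b w; rewrite scalerDl.
- by move=> a b w; rewrite scalerA.
- by move=> a s w; rewrite linearZ.
- exact: opR.
Qed.

Definition rep_fun (x : alg P) (v : V) := term_act (repr x) v.

Lemma rep_fun_cls t v : rep_fun (cls t) v = term_act t v.
Proof. exact/term_act_cong/cong_repr. Qed.

Lemma rep_bilinear : bilinear_for *:%R *:%R rep_fun.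
Proof.
split=> [v|x] a u w /=; last by rewrite /rep_fun linearP.
have [s ->] := cls_surj u; have [t ->] := cls_surj w.
by rewrite -clsZ -clsD !rep_fun_cls.
Qed.

Definition rep : alg P \ot V -> V := tlift rep_bilinear.
HB.instance Definition _ := GRing.Linear.on rep.

Lemma rep_cls t v : rep (cls t \ot v) = term_act t v.
Proof. by rewrite /rep tliftE rep_fun_cls. Qed.
Lemma rep_gen x v : rep (gen x \ot v) = op x v.
Proof. exact: rep_cls. Qed.
Lemma rep1 v : rep (1 \ot v) = v.
Proof. by rewrite -cls1 rep_cls /= scale1r. Qed.
Lemma repM x y v : rep ((x * y) \ot v) = rep (x \ot rep (y \ot v)).
Proof.
have [s ->] := cls_surj x; have [t ->] := cls_surj y.
by rewrite -clsM !rep_cls.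
Qed.

End Representation.

(** * Graded elements and tensors *)

Section Graded.
Variables (K : fieldType) (P : presentation K).

Lemma alg_ind (Q : alg P -> Prop) :
  (forall x, Q (gen x)) -> Q 1 ->
  (forall x y, Q x -> Q y -> Q (x + y)) -> (forall a x, Q x -> Q (a *: x)) ->
  (forall x y, Q x -> Q y -> Q (x * y)) -> forall x, Q x.
Proof.
move=> Qg Q1 QD QZ QM x; have [s ->] := cls_surj x; rewrite clsE.
by elim: s => [y|a|s IHs t IHt|s IHs t IHt] /=; auto.
Qed.

(** Induction on the homogeneous term that represents the element, so that the motive may depend on
    the degree. Zero is a separate case because it lies in every degree, and the product case keeps
    the homogeneity of both factors. *)
Lemma homog_rec (Q : int -> alg P -> Prop) :
  (forall x, Q (deg x) (gen x)) -> Q 0 1 -> (forall n, Q n 0) ->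
  (forall n x y, Q n x -> Q n y -> Q n (x + y)) ->
  (forall n a x, Q n x -> Q n (a *: x)) ->
  (forall m n x y, homog m x -> homog n y -> Q m x -> Q n y -> Q (m + n) (x * y)) ->
  forall n x, homog n x -> Q n x.
Proof.
move=> Qg Q1 Q0 QD QZ QM n _ [t ht ->].
elim: ht => {n t} [x|a|n|n s t _ IHs _ IHt|m n s t hs IHs ht IHt].
- exact: Qg.
- by rewrite clsC; apply: QZ.
- by rewrite clsC scale0r.
- by rewrite clsD; apply: QD.
- by rewrite clsM; apply: QM => //; [exists s|exists t].
Qed.

Lemma homog0 n : homog n (0 : alg P).
Proof. by exists (Cst 0); [apply: thomog_zero|rewrite clsC scale0r]. Qed.

(** For [SU] this span contains both legs of the coproduct of every generator and is stable under
    the action. Statements proved by induction on [H] are first proved on it, where products in [A]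
    do not occur. *)
Inductive gen_span : alg P -> Prop :=
  | gen_span_gen x : gen_span (gen x)
  | gen_span0 : gen_span 0
  | gen_spanD a b : gen_span a -> gen_span b -> gen_span (a + b)
  | gen_spanZ c a : gen_span a -> gen_span (c *: a).

Definition homog_gen_span n a := homog n a /\ gen_span a.

Hypothesis deg_counit : forall x : gens P, deg x != 0 -> counit_gen x = 0.
(** In a product of nonzero total degree at least one factor has nonzero degree, and the counit is
    multiplicative. *)
Lemma counit_homog n (a : alg P) : homog n a -> n != 0 -> counit a = 0.
Proof.
move: n a; apply: homog_rec => [x x0||n|n x y hx hy n0|n c x hx n0|m n x y _ _ hx hy mn0].
- by rewrite /counit lift_gen deg_counit.
- by [].
- by rewrite raddf0.
- by rewrite raddfD /= hx ?hy ?addr0.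
- by rewrite linearZ /= hx ?scaler0.
rewrite rmorphM /=; have [m0|m0] := eqVneq m 0; last by rewrite hx ?mul0r.
by rewrite hy ?mulr0 //; move: mn0; rewrite m0 add0r.
Qed.

End Graded.

(** * Extensionality of linear maps on tensors of homogeneous elements *)

Section Extensionality.
Variables (K : fieldType) (P Q S : presentation K) (W : lmodType K).

Lemma graded_ext2 (f g : {linear (alg P \ot alg Q)%type -> W}) :
  (forall m n x y, homog m x -> homog n y -> f (x \ot y) = g (x \ot y)) ->
  f =1 g.
Proof.
move=> fg; apply: tens_ext => x y.
elim/homog_ind: x => [m x hx|x x' IH IH']; last by rewrite pureDl !linearD IH IH'.
elim/homog_ind: y => [n y hy|y y' IH IH']; last by rewrite pureDr !linearD IH IH'.
exact: fg hx hy.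
Qed.

Lemma graded_ext3 (f g : {linear (alg P \ot alg Q \ot alg S)%type -> W}) :
  (forall m n p x y z, homog m x -> homog n y -> homog p z ->
     f (x \ot y \ot z) = g (x \ot y \ot z)) ->
  f =1 g.
Proof.
move=> fg; apply: tens_ext => w z.
elim/tens_ind: w => [x y|w w' IH IH']; last by rewrite pureDl !linearD IH IH'.
elim/homog_ind: x => [m x hx|x x' IH IH']; last by rewrite !pureDl !linearD IH IH'.
elim/homog_ind: y => [n y hy|y y' IH IH']; last first.
  by rewrite pureDr pureDl !linearD IH IH'.
elim/homog_ind: z => [p z hz|z z' IH IH']; last by rewrite pureDr !linearD IH IH'.
exact: fg hx hy hz.
Qed.

Lemma graded_ext3r (f g : {linear (alg P \ot (alg Q \ot alg S))%type -> W}) :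
  (forall m n p x y z, homog m x -> homog n y -> homog p z ->
     f (x \ot (y \ot z)) = g (x \ot (y \ot z))) ->
  f =1 g.
Proof.
move=> fg; apply: tens_ext => x w.
elim/tens_ind: w => [y z|w w' IH IH']; last by rewrite pureDr !linearD IH IH'.
elim/homog_ind: x => [m x hx|x x' IH IH']; last by rewrite !pureDl !linearD IH IH'.
elim/homog_ind: y => [n y hy|y y' IH IH']; last first.
  by rewrite pureDl pureDr !linearD IH IH'.
elim/homog_ind: z => [p z hz|z z' IH IH']; last by rewrite !pureDr !linearD IH IH'.
exact: fg hx hy hz.
Qed.

End Extensionality.

(** * Total degree on a tensor square *)

Section TensorGrading.
Variables (K : fieldType) (U : lmodType K) (D : int -> U -> Prop).

(** The predicate [D] on the legs is left open: with [homog] this is the usual grading, and with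
    [homog_gen_span] it also records that the legs lie in the span of the generators. *)
Inductive tgraded (n : int) : U \ot U -> Prop :=
  | tgraded_pure m p x y : D m x -> D p y -> n = m + p -> tgraded n (x \ot y)
  | tgraded_add X Y : tgraded n X -> tgraded n Y -> tgraded n (X + Y).

Hypothesis DZ : forall n c x, D n x -> D n (c *: x).
Lemma tgradedZ n c X : tgraded n X -> tgraded n (c *: X).
Proof.
elim=> [m p x y hx hy ->|Y Z _ IH _ IH'].
  by rewrite -pureZl; apply: tgraded_pure (DZ c hx) hy _.
by rewrite scalerDr; apply: tgraded_add.
Qed.
End TensorGrading.

Lemma tgraded_sub (K : fieldType) (U : lmodType K) (D D' : int -> U -> Prop) n X :
  (forall n x, D n x -> D' n x) -> tgraded D n X -> tgraded D' n X.
Proof.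
move=> DD; elim=> [m p x y /DD hx /DD hy ->|Y Z _ IH _ IH'].
  exact: tgraded_pure hx hy _.
exact: tgraded_add.
Qed.

(** * Braidings, coproducts and antipodes *)

Section Braidings.
Variables (K : fieldType) (lam : K) (lam0 : lam != 0).
Variables (P Q : presentation K).
Local Notation Xi := (braid lam0 P Q).

(** The inverse is the braiding in the other direction with parameter [lam^-1]. *)
Lemma braid_bij : bijective Xi.
Proof.
have l0' : lam^-1 != 0 by rewrite invr_eq0.
have lamE m n : lam^-1 ^ (n * m) * lam ^ (m * n) = 1.
  by rewrite exprz_inv (mulrC n) -expfzDr // addNr expr0z.
exists (braid l0' Q P).
  apply: (@graded_ext2 _ _ _ _ (braid l0' Q P \o Xi) idfun) => m n x y hx hy /=.
  by rewrite (braidE _ hx hy) linearZ /= (braidE _ hy hx) scalerA mulrC lamE scale1r.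
apply: (@graded_ext2 _ _ _ _ (Xi \o braid l0' Q P) idfun) => m n x y hx hy /=.
by rewrite (braidE _ hx hy) linearZ /= (braidE _ hy hx) scalerA lamE scale1r.
Qed.

(** The factor lam^(m n) is a bicharacter of the degrees. Additivity of the exponent in each
    variable gives this hexagon identity and the three that follow. *)
Lemma braid_mull : Xi \o tmap (@tmul K (alg P)) (@idfun (alg Q)) =1
  tmap (@idfun (alg Q)) (@tmul K (alg P)) \o @tassoc K (alg Q) (alg P) (alg P)
    \o tmap Xi (@idfun (alg P)) \o @tunassoc K (alg P) (alg Q) (alg P)
    \o tmap (@idfun (alg P)) Xi \o @tassoc K (alg P) (alg P) (alg Q).
Proof.
apply: graded_ext3 => m n p x y z hx hy hz /=.
rewrite tmapE tassocE tmapE /= tmulE (braidE _ (homogM hx hy) hz) (braidE _ hy hz).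
rewrite pureZr !linearZ /= tunassocE tmapE /= (braidE _ hx hz) pureZl.
rewrite !linearZ /= tassocE tmapE /= tmulE scalerA.
by rewrite -expfzDr // mulrDl addrC.
Qed.

Lemma braid_mulr : Xi \o tmap (@idfun (alg P)) (@tmul K (alg Q)) =1
  tmap (@tmul K (alg Q)) (@idfun (alg P)) \o @tunassoc K (alg Q) (alg Q) (alg P)
    \o tmap (@idfun (alg Q)) Xi \o @tassoc K (alg Q) (alg P) (alg Q)
    \o tmap Xi (@idfun (alg Q)) \o @tunassoc K (alg P) (alg Q) (alg Q).
Proof.
apply: graded_ext3r => m n p x y z hx hy hz /=.
rewrite tmapE tunassocE tmapE /= tmulE (braidE _ hx (homogM hy hz)) (braidE _ hx hy).
rewrite pureZl !linearZ /= tassocE tmapE /= (braidE _ hx hz) pureZr.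
rewrite !linearZ /= tunassocE tmapE /= tmulE scalerA.
by rewrite -expfzDr // mulrDr addrC.
Qed.

Section Coproducts.
Variables (DP : {linear alg P -> (alg P \ot alg P)%type}).
Variables (DQ : {linear alg Q -> (alg Q \ot alg Q)%type}).
Hypothesis DP_graded : forall n x, homog n x -> tgraded (@homog K P) n (DP x).
Hypothesis DQ_graded : forall n x, homog n x -> tgraded (@homog K Q) n (DQ x).

Lemma braid_coprodl : tmap (@idfun (alg Q)) DP \o Xi =1
  @tassoc K (alg Q) (alg P) (alg P) \o tmap Xi (@idfun (alg P))
    \o @tunassoc K (alg P) (alg Q) (alg P)
    \o tmap (@idfun (alg P)) Xi \o @tassoc K (alg P) (alg P) (alg Q)
    \o tmap DP (@idfun (alg Q)).
Proof.
apply: graded_ext2 => m n x y hx hy /=.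
rewrite (braidE _ hx hy) linearZ /= !tmapE /=.
elim: (DP_graded hx) => [r p a b ha hb ->|X Y _ IH _ IH']; last first.
  by rewrite pureDr pureDl scalerDr !linearD /= IH IH'.
rewrite tassocE tmapE /= (braidE _ hb hy) pureZr !linearZ /= tunassocE.
rewrite tmapE /= (braidE _ ha hy) pureZl !linearZ /= tassocE scalerA.
by rewrite -expfzDr // mulrDl addrC.
Qed.

Lemma braid_coprodr : tmap DQ (@idfun (alg P)) \o Xi =1
  @tunassoc K (alg Q) (alg Q) (alg P) \o tmap (@idfun (alg Q)) Xi
    \o @tassoc K (alg Q) (alg P) (alg Q)
    \o tmap Xi (@idfun (alg Q)) \o @tunassoc K (alg P) (alg Q) (alg Q)
    \o tmap (@idfun (alg P)) DQ.
Proof.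
apply: graded_ext2 => m n x y hx hy /=.
rewrite (braidE _ hx hy) linearZ /= !tmapE /=.
elim: (DQ_graded hy) => [r p a b ha hb ->|X Y _ IH _ IH']; last first.
  by rewrite pureDr pureDl scalerDr !linearD /= IH IH'.
rewrite tunassocE tmapE /= (braidE _ hx ha) pureZl !linearZ /= tassocE.
rewrite tmapE /= (braidE _ hx hb) pureZr !linearZ /= tunassocE scalerA.
by rewrite -expfzDr // mulrDr addrC.
Qed.

Lemma braid_compatible : compatible_braiding DP DQ Xi.
Proof.
split; [exact: braid_bij|exact: braid_mull|exact: braid_mulr|
  exact: braid_coprodl|exact: braid_coprodr].
Qed.
End Coproducts.
End Braidings.

(** * Graded coproducts, counit and antipode of a presented algebra *)

Section Coproduct.
Variables (K : fieldType) (lam : K) (lam0 : lam != 0) (P : presentation K).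
Local Notation A := (alg P).
Local Notation Psi := (braid lam0 P P).
Local Notation hom := (@homog K P).
Variables (Delta : {linear A -> (A \ot A)%type}) (S : {linear A -> A}).
Hypothesis Delta1 : Delta 1 = 1 \ot 1.
Hypothesis DeltaM : forall x y, Delta (x * y) = btens_mul lam0 (Delta x) (Delta y).
Hypothesis Delta_gen_graded : forall x, tgraded hom (deg x) (Delta (gen x)).

Lemma tgraded_mul m n X Y :
  tgraded hom m X -> tgraded hom n Y -> tgraded hom (m + n) (btens_mul lam0 X Y).
Proof.
elim=> [r p a b ha hb ->|X1 X2 _ IH1 _ IH2 hY]; last first.
  by rewrite btens_mulDl; apply: tgraded_add; [apply: IH1|apply: IH2].
elim=> [s t c d hc hd ->|Y1 Y2 _ IH1 _ IH2]; last first.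
  by rewrite btens_mulDr; apply: tgraded_add.
rewrite (btens_mulE _ _ _ hb hc); apply: tgradedZ => [*|]; first exact: homogZ.
by apply: tgraded_pure (homogM ha hc) (homogM hb hd) _; rewrite addrACA.
Qed.

Lemma coprod_graded n x : homog n x -> tgraded hom n (Delta x).
Proof.
move: n x; apply: homog_rec.
- exact: Delta_gen_graded.
- by rewrite Delta1; apply: tgraded_pure (homog1 P) (homog1 P) _.
(* [tgraded] has no clause for zero, so zero is written as 0 \ot 0 with legs in degrees n and 0. *)
- move=> n; rewrite raddf0 -(pure0l _ 0).
  by apply: tgraded_pure (homog0 P n) (homog0 P 0) _; rewrite addr0.
- by move=> n x y hx hy; rewrite linearD; apply: tgraded_add.
- by move=> n c x hx; rewrite linearZ; apply: tgradedZ => // *; apply: homogZ.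
- by move=> m n x y _ _ hx hy; rewrite DeltaM; apply: tgraded_mul.
Qed.

Section Counit.
Hypothesis deg_counit : forall x : gens P, deg x != 0 -> counit_gen x = 0.
Definition counitr : A \ot A -> A := @runit K A \o tmap (@idfun A) (@counit K P).
HB.instance Definition _ := GRing.Linear.on counitr.
Lemma counitrE a b : counitr (a \ot b) = counit b *: a.
Proof. by rewrite /counitr /= tmapE runitE. Qed.
Hypothesis counitr_gen : forall x, counitr (Delta (gen x)) = gen x.

(** The braiding factor of the product depends on the degree of the second leg of [X]; the counit
    kills that leg unless its degree is 0, and then the factor is 1. *)
Lemma counitrM X Y : counitr (btens_mul lam0 X Y) = counitr X * counitr Y.
Proof.
elim/btens_ind: X => [m n a b ha hb|X X' IH IH']; last first.
  by rewrite btens_mulDl !linearD /= mulrDl IH IH'.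
elim/btens_ind: Y => [r s c d hc hd|Y Y' IH IH']; last first.
  by rewrite btens_mulDr !linearD /= mulrDr IH IH'.
rewrite (btens_mulE _ _ _ hb hc) linearZ /= !counitrE rmorphM /=.
have [n0|/(counit_homog deg_counit hb) ->] := eqVneq n 0; last first.
  by rewrite !(mul0r, scale0r, scaler0).
by rewrite n0 mul0r expr0z scale1r -scalerAl -scalerAr scalerA.
Qed.

Lemma counitr_coprod x : counitr (Delta x) = x.
Proof.
elim/alg_ind: x => [x||x y|a x|x y].
- exact: counitr_gen.
- by rewrite Delta1 counitrE rmorph1 scale1r.
- by rewrite !linearD /= => -> ->.
- by rewrite !linearZ /= => ->.
- by rewrite DeltaM counitrM => -> ->.
Qed.
End Counit.

Section Antipode.
Hypothesis S1 : S 1 = 1.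
Hypothesis SM : forall x y, S (x * y) = bopp_mul lam0 (S x) (S y).
Hypothesis S_gen_homog : forall x, homog (deg x) (S (gen x)).

Lemma antipode_homog n x : homog n x -> homog n (S x).
Proof.
move: n x; apply: homog_rec.
- exact: S_gen_homog.
- by rewrite S1; apply: homog1.
- by move=> n; rewrite raddf0; apply: homog0.
- by move=> n x y hx hy; rewrite linearD; apply: homogD.
- by move=> n c x hx; rewrite linearZ; apply: homogZ.
- move=> m n x y _ _ hx hy; rewrite SM (bopp_mulE _ hx hy).
  by apply: homogZ; rewrite addrC; apply: homogM.
Qed.

Lemma antipodeM m n x y : homog m x -> homog n y ->
  S (x * y) = lam ^ (m * n) *: (S y * S x).
Proof.
by move=> hx hy; rewrite SM (bopp_mulE _ (antipode_homog hx) (antipode_homog hy)).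
Qed.

(** [S] reverses products up to lam^(m n). If m = 0 this factor is 1; otherwise the counit of the
    first factor vanishes and both sides are 0. *)
Lemma counit_antipode :
  (forall x : gens P, deg x != 0 -> counit_gen x = 0) ->
  (forall x, counit (S (gen x)) = counit (gen x)) ->
  forall a, counit (S a) = counit a.
Proof.
move=> deg_counit Sg a.
elim/homog_ind: a => [n a ha|a b IH IH']; last by rewrite !linearD /= IH IH'.
elim/homog_rec: n a / ha => [y||n|n a b IH IH'|n c a IH|m n a b ha hb IH IH'].
- exact: Sg.
- by rewrite S1.
- by rewrite !raddf0.
- by rewrite !linearD /= IH IH'.
- by rewrite !linearZ /= IH.
rewrite (antipodeM ha hb) linearZ /= !rmorphM /= IH IH'.
have [m0|m0] := eqVneq m 0; first by rewrite m0 mul0r expr0z scale1r mulrC.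
by rewrite (counit_homog deg_counit ha m0) mulr0 mul0r scaler0.
Qed.

Definition braided_flip_antipode : A \ot A -> A \ot A := Psi \o tmap S S.
HB.instance Definition _ := GRing.Linear.on braided_flip_antipode.
Local Notation theta := braided_flip_antipode.

Lemma braided_flip_antipodeE m n x y : homog m x -> homog n y ->
  theta (x \ot y) = lam ^ (m * n) *: (S y \ot S x).
Proof.
move=> hx hy; rewrite /theta /= tmapE.
by rewrite (braidE _ (antipode_homog hx) (antipode_homog hy)).
Qed.

(** This is the rule of [antipodeM] one tensor power higher, with the same factor lam^(m n). Hence
    [Delta \o S] and [theta \o Delta] obey the same product rule, and [coprod_antipode] reduces to
    generators. *)
Lemma braided_flip_antipodeM m n X Y : tgraded hom m X -> tgraded hom n Y ->
  theta (btens_mul lam0 X Y) = lam ^ (m * n) *: btens_mul lam0 (theta Y) (theta X).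
Proof.
elim=> [r p a b ha hb ->|X1 X2 _ IH1 _ IH2 hY]; last first.
  by rewrite btens_mulDl !linearD /= btens_mulDr scalerDr IH1 ?IH2.
elim=> [s t c d hc hd ->|Y1 Y2 _ IH1 _ IH2]; last first.
  by rewrite btens_mulDr !linearD /= btens_mulDl scalerDr IH1 ?IH2.
rewrite (btens_mulE _ _ _ hb hc) linearZ /=.
rewrite (braided_flip_antipodeE (homogM ha hc) (homogM hb hd)).
rewrite (braided_flip_antipodeE ha hb) (braided_flip_antipodeE hc hd).
rewrite btens_mulZl btens_mulZr.
rewrite (btens_mulE _ _ _ (antipode_homog hc) (antipode_homog hb)).
rewrite (antipodeM ha hc) (antipodeM hb hd).
rewrite pureZl pureZr !scalerA -!expfzDr //.
by congr (_ ^ _ *: _); ring.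
Qed.

Hypothesis coprod_antipode_gen : forall x, Delta (S (gen x)) = theta (Delta (gen x)).
Lemma coprod_antipode x : Delta (S x) = theta (Delta x).
Proof.
elim/homog_ind: x => [n x hx|x y IH IH']; last by rewrite !linearD /= IH IH'.
elim/homog_rec: n x / hx => [x|||n x y IH IH'|n c x IH|m n x y hx hy IH IH'].
- exact: coprod_antipode_gen.
- rewrite S1 Delta1 (braided_flip_antipodeE (homog1 P) (homog1 P)).
  by rewrite mul0r expr0z scale1r S1.
- by move=> n; rewrite !raddf0.
- by rewrite !linearD /= IH IH'.
- by rewrite !linearZ /= IH.
rewrite (antipodeM hx hy) linearZ /= !DeltaM IH IH'.
by rewrite (braided_flip_antipodeM (coprod_graded hx) (coprod_graded hy)).
Qed.
End Antipode.
End Coproduct.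

(** * The pairing of a graded action *)

HB.instance Definition _ (K : fieldType) (H A : algType K)
  (p : {linear (H \ot A)%type -> K^o}) := GRing.Linear.on (pair2 p).

Section ActionPairing.
Variables (K : fieldType) (lam : K) (lam0 : lam != 0) (P Q : presentation K).
Local Notation H := (alg P).
Local Notation A := (alg Q).
Local Notation homH := (@homog K P).
Local Notation homA := (@homog K Q).
Local Notation Xi := (braid lam0 P Q).
Variables (DH : {linear H -> (H \ot H)%type}) (DA : {linear A -> (A \ot A)%type}).
Hypothesis DH1 : DH 1 = 1 \ot 1.
Hypothesis DHM : forall x y : H, DH (x * y) = btens_mul lam0 (DH x) (DH y).
Hypothesis DH_gen : forall x, tgraded homH (deg x) (DH (gen x)).
Hypothesis DA1 : DA 1 = 1 \ot 1.
Hypothesis DAM : forall x y : A, DA (x * y) = btens_mul lam0 (DA x) (DA y).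
Hypothesis DA_gen : forall x, tgraded (@homog_gen_span K Q) (deg x) (DA (gen x)).
Hypothesis degH_counit : forall x : gens P, deg x != 0 -> counit_gen x = 0.
Hypothesis degA_counit : forall x : gens Q, deg x != 0 -> counit_gen x = 0.
Hypothesis counitr_gen : forall x, counitr (DA (gen x)) = gen x.

Variable act : {linear (H \ot A)%type -> A}.

Definition tact : (H \ot H) \ot (A \ot A) -> A \ot A := tmap act act \o tmid Xi.
HB.instance Definition _ := GRing.Linear.on tact.

(** The action on the second leg, with [x] braided past the first one: the right-hand side of the
    compatibility of the action with the coproduct of [A]. *)
Definition coact : H \ot (A \ot A) -> A \ot A :=
  tmap (@idfun A) act \o @tassoc K A H A \o tmap Xi (@idfun A) \o @tunassoc K H A A.
HB.instance Definition _ := GRing.Linear.on coact.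

Lemma tactE m n x y a b : homog m y -> homog n a ->
  tact (x \ot y \ot (a \ot b)) = lam ^ (m * n) *: (act (x \ot a) \ot act (y \ot b)).
Proof.
by move=> hy ha; rewrite /tact /= (tmidE _ _ (braidE _ hy ha)) linearZ /= tmapE.
Qed.

Lemma coactE m n x a b : homog m x -> homog n a ->
  coact (x \ot (a \ot b)) = lam ^ (m * n) *: (a \ot act (x \ot b)).
Proof.
move=> hx ha; rewrite /coact /= tunassocE tmapE /= (braidE _ hx ha) pureZl.
by rewrite !linearZ /= tassocE tmapE.
Qed.

Hypothesis act1 : forall a, act (1 \ot a) = a.
Hypothesis actM : forall (x y : H) a, act ((x * y) \ot a) = act (x \ot act (y \ot a)).
Hypothesis act_gen_homog : forall x n a, homog n a ->
  homog (deg x + n) (act (gen x \ot a)).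
Hypothesis act_gen_unit : forall x, act (gen x \ot 1) = (counit (gen x) : K) *: (1 : A).
Hypothesis act_gen_mul : forall x a b,
  act (gen x \ot (a * b)) = tmul (tact (DH (gen x) \ot (a \ot b))).
Hypothesis act_gen_span : forall x y, gen_span (act (gen x \ot gen y)).
Hypothesis coprod_act_gen : forall x y,
  DA (act (gen x \ot gen y)) = coact (gen x \ot DA (gen y)).

Lemma act_homog m n x a : homog m x -> homog n a -> homog (m + n) (act (x \ot a)).
Proof.
move=> hx; elim/homog_rec: m x / hx n a =>
    [x||k|m x y IH IH'|m c x IH|m p x y _ _ IH IH'] n a ha.
- exact: act_gen_homog.
- by rewrite act1 add0r.
- by rewrite pure0l raddf0; apply: homog0.
- by rewrite pureDl linearD; apply: homogD; auto.
- by rewrite pureZl linearZ; apply: homogZ; auto.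
- by rewrite actM -addrA; auto.
Qed.

Lemma act_unit x : act (x \ot 1) = (counit x : K) *: (1 : A).
Proof.
elim/alg_ind: x => [//||x y IH IH'|c x IH|x y IH IH'].
- by rewrite act1 rmorph1 scale1r.
- by rewrite pureDl !linearD /= IH IH' scalerDl.
- by rewrite pureZl !linearZ /= IH scalerA.
- by rewrite actM IH' pureZr linearZ /= IH rmorphM /= scalerA mulrC.
Qed.

Lemma tact1 w : tact (1 \ot 1 \ot w) = w.
Proof.
elim/btens_ind: w => [m n a b ha hb|w w' IH IH'].
  by rewrite (tactE _ _ (homog1 P) ha) mul0r expr0z scale1r !act1.
by rewrite pureDr linearD /= IH IH'.
Qed.

(** The braided tensor square of [H] acts on [A \ot A]. Gradedness of the action determines the
    degree of the leg past which [X] is moved, and then the exponents of [lam] on both sides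
    agree. *)
Lemma tactM X Y w : tact (btens_mul lam0 X Y \ot w) = tact (X \ot tact (Y \ot w)).
Proof.
elim/btens_ind: X => [m n x y hx hy|X X' IH IH']; last first.
  by rewrite btens_mulDl !pureDl !linearD /= IH IH'.
elim/btens_ind: Y => [p r z t hz ht|Y Y' IH IH']; last first.
  by rewrite btens_mulDr !pureDl !linearD /= pureDr linearD /= IH IH'.
elim/btens_ind: w => [s u a b ha hb|w w' IH IH']; last first.
  by rewrite !pureDr !linearD /= pureDr linearD /= IH IH'.
rewrite (btens_mulE _ _ _ hy hz) pureZl linearZ /= (tactE _ _ (homogM hy ht) ha).
rewrite scalerA (tactE _ _ ht ha) pureZr linearZ /= (tactE _ _ hy (act_homog hz ha)).
rewrite !actM !scalerA -!expfzDr //.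
by congr (_ ^ _ *: _); ring.
Qed.

Lemma act_mul x a b : act (x \ot (a * b)) = tmul (tact (DH x \ot (a \ot b))).
Proof.
(* The induction on [x] needs arbitrary tensors: in the product case the second factor turns a pure
   tensor into a sum. *)
suff: forall w, act (x \ot tmul w) = tmul (tact (DH x \ot w)).
  by move/(_ (a \ot b)); rewrite tmulE.
elim/alg_ind: x => [x||x y IH IH'|c x IH|x y IH IH'] w.
- elim/tens_ind: w => [{}a {}b|w w' IH IH']; first by rewrite tmulE.
  by rewrite linearD !pureDr !linearD /= IH IH'.
- by rewrite DH1 tact1 act1.
- by rewrite pureDl !linearD /= pureDl !linearD /= IH IH'.
- by rewrite pureZl !linearZ /= pureZl !linearZ /= IH.
- by rewrite DHM tactM actM IH' IH.
Qed.

Lemma DH_graded n x : homog n x -> tgraded homH n (DH x).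
Proof. by move=> hx; apply: coprod_graded DH1 DHM DH_gen _ _ hx. Qed.

Lemma DA_gen_graded x : tgraded homA (deg x) (DA (gen x)).
Proof. by apply: tgraded_sub (DA_gen x) => n a []. Qed.

Lemma DA_graded n a : homog n a -> tgraded homA n (DA a).
Proof. by move=> ha; apply: coprod_graded DA1 DAM DA_gen_graded _ _ ha. Qed.

(** * Compatibility of the action with the coproduct of [A] *)

Lemma coact1 X : coact (1 \ot X) = X.
Proof.
elim/btens_ind: X => [m n a b ha hb|X X' IH IH'].
  by rewrite (coactE _ (homog1 P) ha) mul0r expr0z scale1r act1.
by rewrite pureDr linearD /= IH IH'.
Qed.

Lemma coactM x y X : coact ((x * y) \ot X) = coact (x \ot coact (y \ot X)).
Proof.
elim/homog_ind: x => [m x hx|x x' IH IH']; last first.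
  by rewrite mulrDl !pureDl !linearD /= IH IH'.
elim/homog_ind: y => [n y hy|y y' IH IH']; last first.
  by rewrite mulrDr !pureDl !linearD /= pureDr linearD /= IH IH'.
elim/btens_ind: X => [p r a b ha hb|X X' IH IH']; last first.
  by rewrite !pureDr !linearD /= pureDr linearD /= IH IH'.
rewrite (coactE _ (homogM hx hy) ha) (coactE _ hy ha) pureZr linearZ /=.
by rewrite (coactE _ hx ha) actM scalerA -expfzDr // -mulrDl addrC.
Qed.

Lemma act_span x a : gen_span a -> gen_span (act (x \ot a)).
Proof.
elim/alg_ind: x a => [x||x y IH IH'|c x IH|x y IH IH'] a sa.
- elim: sa => [y||{}a b _ sa _ sb|c {}a _ sa].
  + exact: act_gen_span.
  + by rewrite pure0r raddf0; apply: gen_span0.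
  + by rewrite pureDr linearD; apply: gen_spanD.
  + by rewrite pureZr linearZ; apply: gen_spanZ.
- by rewrite act1.
- by rewrite pureDl linearD; apply: gen_spanD; auto.
- by rewrite pureZl linearZ; apply: gen_spanZ; auto.
- by rewrite actM; auto.
Qed.

(** Both sides are actions in [x], so the identity passes from generators to products, provided that
    [act (y \ot a)] stays in the span; this is [act_span]. *)
Lemma coprod_act_span x a : gen_span a -> DA (act (x \ot a)) = coact (x \ot DA a).
Proof.
elim/alg_ind: x a => [x||x y IH IH'|c x IH|x y IH IH'] a sa.
- elim: sa => [y||{}a b _ IH _ IH'|c {}a _ IH].
  + exact: coprod_act_gen.
  + by rewrite pure0r !raddf0 pure0r raddf0.
  + by rewrite pureDr !linearD /= pureDr linearD /= IH IH'.
  + by rewrite pureZr !linearZ /= pureZr linearZ /= IH.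
- by rewrite act1 coact1.
- by rewrite !pureDl !linearD /= IH ?IH'.
- by rewrite !pureZl !linearZ /= IH.
- by rewrite actM coactM IH ?IH' //; apply: act_span.
Qed.

(* [X] of degree [n] acts on the second pair of factors, past the first one. *)
Section Coleib.
Variables (n : int) (X : H \ot H).
Definition tact_mul (w : A \ot A) : A := tmul (tact (X \ot w)).
Lemma tact_mul_linear : linear tact_mul.
Proof. by move=> c w w'; rewrite /tact_mul pureDr pureZr !linearP. Qed.
HB.instance Definition _ :=
  GRing.isLinear.Build K (A \ot A)%type A *:%R tact_mul tact_mul_linear.
Definition coleib : A \ot A \ot (A \ot A) -> A \ot A :=
  tmap (dil (P := Q) (lam_neq0 lam0 n) \o @tmul K A) tact_mul.
HB.instance Definition _ := GRing.Linear.on coleib.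
End Coleib.

Lemma coleibE n m p X a b w : homog m a -> homog p b ->
  coleib n X (a \ot b \ot w) = lam ^ ((m + p) * n) *: ((a * b) \ot tmul (tact (X \ot w))).
Proof.
by move=> ha hb; rewrite /coleib tmapE /= tmulE (dil_lam _ _ (homogM ha hb)) pureZl.
Qed.

Lemma coleibD n X X' w : coleib n (X + X') w = coleib n X w + coleib n X' w.
Proof.
elim/tens_ind: w => [a b|w w' IH IH']; last by rewrite !linearD /= IH IH' addrACA.
by rewrite /coleib !tmapE /= /tact_mul pureDl !linearD /= pureDr.
Qed.

(** The degree of [x] enters [coleib] as a separate parameter. The right-hand side is therefore
    linear in [DH x], which can afterwards be split into pure tensors. *)
Lemma coact_mul n x Y Z : homog n x ->
  coact (x \ot btens_mul lam0 Y Z) = coleib n (DH x) (tmid (braid lam0 Q Q) (Y \ot Z)).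
Proof.
move=> hx; elim/btens_ind: Y => [r s b1 b2 h1 h2|Y Y' IH IH']; last first.
  by rewrite btens_mulDl pureDr pureDl !linearD /= IH IH'.
elim/btens_ind: Z => [t u c1 c2 h3 h4|Z Z' IH IH']; last first.
  by rewrite btens_mulDr !pureDr !linearD /= IH IH'.
rewrite (btens_mulE _ _ _ h2 h3) (tmidE _ _ (braidE _ h2 h3)) pureZr !linearZ /=.
by rewrite (coactE _ hx (homogM h1 h3)) (coleibE _ _ _ h1 h3) act_mul (mulrC n).
Qed.

Lemma coprod_act x a : DA (act (x \ot a)) = coact (x \ot DA a).
Proof.
elim/homog_ind: a => [n a ha|a a' IH IH']; last first.
  by rewrite pureDr !linearD /= pureDr linearD /= IH IH'.
(* [x] is generalized because the product case applies the induction hypotheses to the two legs of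
   [DH x]. *)
elim/homog_rec: n a / ha x => [y||n|n a b IH IH'|n c a IH|m n a b ha hb IH IH'] x.
- exact/coprod_act_span/gen_span_gen.
- rewrite act_unit linearZ /= DA1; elim/homog_ind: x => [n x hx|x x' IH IH'].
    by rewrite (coactE _ hx (homog1 Q)) mulr0 expr0z scale1r act_unit pureZr.
  by rewrite pureDl !linearD /= scalerDl IH IH'.
- by rewrite pure0r !raddf0 pure0r raddf0.
- by rewrite pureDr !linearD /= pureDr linearD /= IH IH'.
- by rewrite pureZr !linearZ /= pureZr linearZ /= IH.
elim/homog_ind: x => [p x hx|x x' IHx IHx']; last first.
  by rewrite !pureDl !linearD /= IHx IHx'.
rewrite DAM (coact_mul _ _ hx) act_mul.
elim: (DH_graded hx) => {x hx} [r s x y hx hy ->|X Y _ IHX _ IHY]; last first.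
  by rewrite pureDl !linearD coleibD IHX IHY.
rewrite (tactE _ _ hy ha) !linearZ /= tmulE DAM IH IH'.
elim: (DA_graded ha) => [t u b1 b2 h1 h2 ->|Y Y' _ IHY _ IHY']; last first.
  by rewrite pureDr pureDl !linearD /= btens_mulDl scalerDr IHY IHY'.
elim: (DA_graded hb) => [v w c1 c2 h3 h4 _|Z Z' _ IHZ _ IHZ']; last first.
  by rewrite !pureDr !linearD /= btens_mulDr scalerDr IHZ IHZ'.
rewrite (coactE _ hx h1) (coactE _ hy h3) btens_mulZl btens_mulZr.
rewrite (btens_mulE _ _ _ (act_homog hx h2) h3) !scalerA (tmidE _ _ (braidE _ h2 h3)).
rewrite linearZ /= (coleibE _ _ _ h1 h3) scalerA (tactE _ _ hy h2) linearZ /= tmulE.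
rewrite pureZr !scalerA -!expfzDr //.
(* Both exponents equal (r + s) (t + v) + s u + u v. *)
by congr (_ ^ _ *: _); ring.
Qed.

(** * The product axioms of the pairing and the sliding identities *)

Definition pairing : H \ot A -> K^o := @counit K Q \o act.
HB.instance Definition _ := GRing.Linear.on pairing.
Local Notation p := pairing.

Lemma pairing_homog m n x a : homog m x -> homog n a -> m + n != 0 -> p (x \ot a) = 0.
Proof. by move=> hx ha; apply/(counit_homog degA_counit)/act_homog. Qed.

(* Pairings vanish outside total degree 0, so a braiding factor in front of one
   may be rewritten assuming [n = - m]. *)
Lemma pairing_twist m n x a (c c' : K) : homog m x -> homog n a ->
  (n = - m -> c = c') -> c * p (x \ot a) = c' * p (x \ot a).
Proof.
move=> hx ha cc; have [mn|mn] := eqVneq (m + n) 0; last first.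
  by rewrite (pairing_homog hx ha mn) !mulr0.
by rewrite cc //; apply/eqP; rewrite -addr_eq0 addrC mn.
Qed.

Lemma pairing_twist2 m n k l x a y b (c c' : K) :
  homog m x -> homog n a -> homog k y -> homog l b ->
  (n = - m -> l = - k -> c = c') ->
  c * (p (x \ot a) * p (y \ot b)) = c' * (p (x \ot a) * p (y \ot b)).
Proof.
move=> hx ha hy hb cc; rewrite !mulrA; apply: (pairing_twist hy hb) => lk.
by apply: (pairing_twist hx ha) => nm; apply: cc.
Qed.

Lemma scale_regular_mul (c d : K) (e : K^o) : c *: (d * e : K^o) = c * d * e.
Proof. exact: mulrA. Qed.

Lemma pair2E m n x y a b : homog m y -> homog n a ->
  pair2 p (tmid Xi (x \ot y \ot (a \ot b))) =
  lam ^ (m * n) * (p (x \ot a) * p (y \ot b)).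
Proof.
move=> hy ha; rewrite (tmidE _ _ (braidE _ hy ha)) /pair2 /= !linearZ /=.
by rewrite tmapE tmulE.
Qed.

Lemma pairing_coprodH x a b :
  p (x \ot (a * b)) = pair2 p (tmid Xi (DH x \ot (a \ot b))).
Proof.
rewrite /pairing /= act_mul /tact /=.
elim/tens_ind: (tmid Xi _) => [u v|w w' IH IH']; last first.
  by rewrite !linearD /= IH IH'.
by rewrite /pair2 /= !tmapE !tmulE rmorphM.
Qed.

(** Applying id \ot eps to [coprod_act] recovers h |> a = sum lam^(|h| |a1|) <h, a2> a1 for the
    abstract action. *)
Lemma act_coprodA x a : act (x \ot a) = counitr (coact (x \ot DA a)).
Proof.
by rewrite -coprod_act (counitr_coprod DA1 DAM degA_counit counitr_gen).
Qed.

Lemma pairing_coprodA x y a :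
  p ((x * y) \ot a) = pair2 p (tmid Xi (x \ot y \ot DA a)).
Proof.
rewrite /pairing /= actM (act_coprodA y).
elim/homog_ind: y => [n y hy|y y' IH IH']; last first.
  rewrite pureDr !pureDl !linearD /= pureDr !linearD /= IH IH' //.
elim/btens_ind: (DA a) => [r s b c hb hc|X X' IH IH']; last first.
  by rewrite !pureDr !linearD /= pureDr !linearD /= IH IH'.
rewrite (pair2E _ _ hy hb) (coactE _ hy hb) linearZ /= counitrE pureZr.
by rewrite pureZr !linearZ /=; congr (_ * _); apply: mulrC.
Qed.

(** The two braidings contribute lam^((m + n) r), where m and n are the degrees of the paired
    elements [x] and [a]; the pairing vanishes unless m + n = 0. The other sliding identity is
    dual. *)
Lemma pairing_slide_target :
  pairing_slideA (braid lam0 Q Q) Xi p.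
Proof.
apply: graded_ext3r => m n r x a b hx ha hb /=.
rewrite tmapE /= (braidE _ ha hb) pureZr !linearZ /= tunassocE tmapE /=.
rewrite (braidE _ hx hb) pureZl !linearZ /= tassocE tmapE runitE tunassocE tmapE.
rewrite lunitE /= !scalerA -expfzDr //.
rewrite (pairing_twist (c' := 1) hx ha) ?mul1r // => ->.
by rewrite mulNr subrr expr0z.
Qed.

Lemma pairing_slide_source :
  pairing_slideH (braid lam0 P P) Xi p.
Proof.
apply: graded_ext3 => m n r x y a hx hy ha /=.
rewrite tmapE /= (braidE _ hx hy) pureZl !linearZ /= tassocE tmapE /=.
rewrite (braidE _ hx ha) pureZr !linearZ /= tunassocE tmapE lunitE tassocE tmapE.
rewrite runitE /= !scalerA -expfzDr //.
rewrite (pairing_twist (c' := 1) hy ha) ?mul1r // => ->.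
by rewrite mulrN addNr expr0z.
Qed.

(** * The antipode axiom *)

Variables (SH : {linear H -> H}) (SA : {linear A -> A}).
Hypothesis SH1 : SH 1 = 1.
Hypothesis SHM : forall x y : H, SH (x * y) = bopp_mul lam0 (SH x) (SH y).
Hypothesis SH_gen : forall x, homog (deg x) (SH (gen x)).
Hypothesis SA1 : SA 1 = 1.
Hypothesis SAM : forall x y : A, SA (x * y) = bopp_mul lam0 (SA x) (SA y).
Hypothesis SA_gen : forall x, homog (deg x) (SA (gen x)).
Hypothesis DSH_gen : forall x,
  DH (SH (gen x)) = braided_flip_antipode lam0 SH (DH (gen x)).
Hypothesis DSA_gen : forall x,
  DA (SA (gen x)) = braided_flip_antipode lam0 SA (DA (gen x)).
Hypothesis counit_SH_gen : forall x, counit (SH (gen x)) = counit (gen x).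
Hypothesis counit_SA_gen : forall x, counit (SA (gen x)) = counit (gen x).
Hypothesis pairing_S_gen : forall x y,
  p (SH (gen x) \ot gen y) = p (gen x \ot SA (gen y)).

Lemma pairing_unit x : p (x \ot 1) = counit x.
Proof. by rewrite /pairing /= act_unit linearZ /= rmorph1 [LHS]mulr1. Qed.

Lemma pairing_one a : p (1 \ot a) = counit a.
Proof. by rewrite /pairing /= act1. Qed.

Let SHh := antipode_homog SH1 SHM SH_gen.
Let SAh := antipode_homog SA1 SAM SA_gen.
Let SHmul := antipodeM SH1 SHM SH_gen.
Let SAmul := antipodeM SA1 SAM SA_gen.
Let flipH := braided_flip_antipodeE SH1 SHM SH_gen.
Let flipA := braided_flip_antipodeE SA1 SAM SA_gen.
Let DSH := coprod_antipode DH1 DHM DH_gen SH1 SHM SH_gen DSH_gen.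
Let DSA := coprod_antipode DA1 DAM DA_gen_graded SA1 SAM SA_gen DSA_gen.

(** First half of a double induction. For a product in [H] the coproduct of a generator of [A] is
    used, whose legs are again in the span, so the hypotheses apply to them. [pairing_antipode] then
    treats products in [A] through the coproduct of [H]. *)
Lemma pairing_antipode_span x a : gen_span a -> p (SH x \ot a) = p (x \ot SA a).
Proof.
elim/homog_ind: x => [m x hx|x y IH IH' sa]; last first.
  by rewrite !linearD /= !pureDl !linearD /= IH ?IH'.
elim/homog_rec: m x / hx a => [x||m|m x y IH IH'|m c x IH|m n x y hx hy IH IH'] a sa.
- elim: sa => [y||{}a b _ IH _ IH'|c {}a _ IH].
  + exact: pairing_S_gen.
  + by rewrite !raddf0 !pure0r !raddf0.
  + by rewrite !linearD /= !pureDr !linearD /= IH IH'.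
  + by rewrite !linearZ /= !pureZr !linearZ /= IH.
- by rewrite SH1 !pairing_one (counit_antipode SA1 SAM SA_gen degA_counit counit_SA_gen).
- by rewrite raddf0 !pure0l.
- by rewrite !linearD /= !pureDl !linearD /= IH ?IH'.
- by rewrite !linearZ /= !pureZl !linearZ /= IH.
elim: sa => [u||{}a b _ IHa _ IHb|c {}a _ IHa].
- rewrite (SHmul hx hy) pureZl linearZ /= !pairing_coprodA DSA.
  elim: (DA_gen u) => [r s {}a b [ha sa] [hb sb] _|X Y _ IHX _ IHY]; last first.
    by rewrite !linearD /= !pureDr !linearD /= ?scalerDr IHX IHY.
  rewrite (flipA ha hb) pureZr !linearZ /= (pair2E _ _ (SHh hx) ha).
  rewrite (pair2E _ _ hy (SAh hb)) IH // IH' // [X in _ = _ *: (_ * X)]mulrC.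
  rewrite !scale_regular_mul.
  (* The two pairings vanish unless r = - n and s = - m. Under these equations both exponents, m n +
     m r and r s + n s, are 0. *)
  apply: pairing_twist2 hy (SAh ha) hx (SAh hb) _ => -> ->.
  rewrite -!expfzDr //; congr (_ ^ _); ring.
- by rewrite !raddf0 !pure0r !raddf0.
- by rewrite !linearD /= !pureDr !linearD /= IHa IHb.
- by rewrite !linearZ /= !pureZr !linearZ /= IHa.
Qed.

Lemma pairing_antipode x a : p (SH x \ot a) = p (x \ot SA a).
Proof.
elim/homog_ind: a => [n a ha|a b IH IH']; last first.
  by rewrite !linearD /= !pureDr !linearD /= IH IH'.
elim/homog_rec: n a / ha x => [y||n|n a b IH IH'|n c a IH|m n a b ha hb IH IH'] x.
- exact/pairing_antipode_span/gen_span_gen.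
- by rewrite SA1 !pairing_unit (counit_antipode SH1 SHM SH_gen degH_counit counit_SH_gen).
- by rewrite raddf0 !pure0r.
- by rewrite !linearD /= !pureDr !linearD /= IH IH'.
- by rewrite !linearZ /= !pureZr !linearZ /= IH.
rewrite (SAmul ha hb) pureZr linearZ /= !pairing_coprodH DSH.
elim/homog_ind: x => [k x hx|x y IHx IHy]; last first.
  by rewrite !linearD /= !pureDl !linearD /= ?scalerDr IHx IHy.
elim: (DH_graded hx) => {x hx} [r s x y hx hy _|X Y _ IHX _ IHY]; last first.
  by rewrite !linearD /= !pureDl !linearD /= ?scalerDr IHX IHY.
rewrite (flipH hx hy) pureZl !linearZ /= (pair2E _ _ (SHh hx) ha).
rewrite (pair2E _ _ hy (SAh hb)) IH IH' [X in _ = _ *: (_ * X)]mulrC.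
rewrite !scale_regular_mul.
apply: pairing_twist2 hy (SAh ha) hx (SAh hb) _ => -> ->.
rewrite -!expfzDr //; congr (_ ^ _); ring.
Qed.

Lemma pairing_braided :
  braided_pairing DH SH (@counit K P) DA SA (@counit K Q) Xi p.
Proof.
split.
- by apply: braid_compatible; [apply: DH_graded|apply: DA_graded].
- apply: graded_ext3r => m n r x a b _ _ _ /=.
  by rewrite !tmapE /= tmulE pairing_coprodH.
- apply: graded_ext3 => m n r x y a _ _ _ /=.
  by rewrite !tmapE /= tmulE pairing_coprodA.
- exact: pairing_antipode.
- exact: pairing_one.
- exact: pairing_unit.
Qed.

End ActionPairing.

(** * Skew derivations *)

Section Triangular.
Variables (K : fieldType) (B : algType K).

(* [(a, x, b)] stands for the upper triangular matrix [[a, x], [0, b]]. *)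
Definition triang : Type := (B * B * B)%type.
HB.instance Definition _ := GRing.Lmodule.on triang.

Definition triang_mul (u v : triang) : triang :=
  (u.1.1 * v.1.1, u.1.1 * v.1.2 + u.1.2 * v.2, u.2 * v.2).

Lemma triang_mulA : associative triang_mul.
Proof.
move=> [[a x] b] [[c y] d] [[e z] f]; rewrite /triang_mul /=.
by rewrite mulrDr mulrDl !mulrA addrA.
Qed.
Lemma triang_mul1 : left_id (1, 0, 1) triang_mul.
Proof. by move=> [[a x] b]; rewrite /triang_mul /= !mul1r mul0r addr0. Qed.
Lemma triang_mulr1 : right_id (1, 0, 1) triang_mul.
Proof. by move=> [[a x] b]; rewrite /triang_mul /= !mulr1 mulr0 add0r. Qed.
Lemma triang_mulDl : left_distributive triang_mul +%R.
Proof.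
move=> [[a x] b] [[c y] d] [[e z] f]; rewrite /triang_mul /=.
by congr (_, _, _); rewrite /= !mulrDl // addrACA.
Qed.
Lemma triang_mulDr : right_distributive triang_mul +%R.
Proof.
move=> [[a x] b] [[c y] d] [[e z] f]; rewrite /triang_mul /=.
by congr (_, _, _); rewrite /= !mulrDr // addrACA.
Qed.
Lemma triang1_neq0 : (1, 0, 1) != 0 :> triang.
Proof. by apply/eqP => -[/eqP]; rewrite oner_eq0. Qed.
HB.instance Definition _ := GRing.Zmodule_isNzRing.Build triang
  triang_mulA triang_mul1 triang_mulr1 triang_mulDl triang_mulDr triang1_neq0.

Lemma triangM (u v : triang) :
  u * v = (u.1.1 * v.1.1, u.1.1 * v.1.2 + u.1.2 * v.2, u.2 * v.2).
Proof. by []. Qed.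
Lemma triangD (u v : triang) : u + v = (u.1.1 + v.1.1, u.1.2 + v.1.2, u.2 + v.2).
Proof. by []. Qed.
Lemma triangZ c (u : triang) : c *: u = (c *: u.1.1, c *: u.1.2, c *: u.2).
Proof. by []. Qed.
Lemma triang1 : (1 : triang) = (1, 0, 1).
Proof. by []. Qed.

Lemma triang_scaleAl c (u v : triang) : c *: (u * v) = (c *: u : triang) * v.
Proof. by rewrite !triangZ !triangM /= scalerDr !scalerAl. Qed.
HB.instance Definition _ := GRing.Lmodule_isLalgebra.Build K triang triang_scaleAl.
Lemma triang_scaleAr c (u v : triang) : c *: (u * v) = u * (c *: v : triang).
Proof. by rewrite !triangZ !triangM /= scalerDr !scalerAr. Qed.
HB.instance Definition _ := GRing.Lalgebra_isAlgebra.Build K triang triang_scaleAr.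
End Triangular.

Section SkewDerivations.
Variables (K : fieldType) (Q : presentation K).
Local Notation A := (alg Q).

Lemma lrmorph_ext (B : algType K) (f g : {lrmorphism A -> B}) :
  (forall x, f (gen x) = g (gen x)) -> f =1 g.
Proof.
move=> fg; elim/alg_ind=> [//||a b IH IH'|c a IH|a b IH IH'].
- by rewrite !rmorph1.
- by rewrite !rmorphD /= IH IH'.
- by rewrite !linearZ /= IH.
- by rewrite !rmorphM /= IH IH'.
Qed.

Definition skew_derivation (sg tau D : A -> A) : Prop :=
  forall a b, D (a * b) = sg a * D b + D a * tau b.

Section Commutation.
Variables (sg tau : {lrmorphism A -> A}) (D : {linear A -> A}).
Hypothesis Dskew : skew_derivation sg tau D.

Lemma skew_derivation1 : D 1 = 0.
Proof.
have := Dskew 1 1; rewrite mulr1 !rmorph1 mul1r mulr1 => /eqP.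
by rewrite -subr_eq0 opprD addrA subrr add0r oppr_eq0 => /eqP.
Qed.

(** Since [T] commutes with [sg] and [tau], the maps [D \o T] and [c *: (T \o D)] satisfy the same
    twisted Leibniz rule, so it is enough that they agree on generators. *)
Lemma skew_derivation_comm (T : {lrmorphism A -> A}) (c : K) :
  (forall x, sg (T (gen x)) = T (sg (gen x))) ->
  (forall x, tau (T (gen x)) = T (tau (gen x))) ->
  (forall x, D (T (gen x)) = c *: T (D (gen x))) ->
  forall a, D (T a) = c *: T (D a).
Proof.
move=> sT tT DT.
have {}sT : sg \o T =1 T \o sg by apply: lrmorph_ext.
have {}tT : tau \o T =1 T \o tau by apply: lrmorph_ext.
elim/alg_ind=> [//||a b IH IH'|d a IH|a b IH IH'].
- by rewrite rmorph1 skew_derivation1 rmorph0 scaler0.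
- by rewrite !linearD /= IH IH' ?scalerDr.
- by rewrite !linearZ /= IH !scalerA mulrC.
rewrite rmorphM !Dskew IH IH' rmorphD !rmorphM /= scalerDr.
have /= -> := sT a; have /= -> := tT b.
by rewrite -scalerAl -scalerAr.
Qed.

Lemma skew_derivation_homog d : (forall n a, homog n a -> homog n (sg a)) ->
  (forall n a, homog n a -> homog n (tau a)) ->
  (forall x, homog (d + deg x) (D (gen x))) ->
  forall n a, homog n a -> homog (d + n) (D a).
Proof.
move=> hs ht hD; apply: homog_rec => [//||n|n a b IH IH'|n c a IH|m n a b ha hb IH IH'].
- by rewrite skew_derivation1; apply: homog0.
- by rewrite raddf0; apply: homog0.
- by rewrite linearD; apply: homogD.
- by rewrite linearZ; apply: homogZ.
rewrite Dskew; apply: homogD.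
  by rewrite addrCA; apply: homogM => //; apply: hs.
by rewrite addrA; apply: homogM => //; apply: ht.
Qed.

End Commutation.
End SkewDerivations.

(** * The action of U_(q, phi)(u(2)^) on SU_(q, phi)(2) *)

Section SUMaps.
Variables (R : realType) (q phi : R) (q01 : 0 < q < 1).
Local Notation C := R[i].
Local Notation qC := (real_complex R q).
Local Notation A := (alg (SU q phi)).
Local Notation al := (@gen C (SU q phi) su_alpha).
Local Notation ga := (@gen C (SU q phi) su_gamma).
Local Notation als := (@gen C (SU q phi) su_alphas).
Local Notation gas := (@gen C (SU q phi) su_gammas).
Local Notation one := (su_one q phi).

(** The weights involve q^(1/2). With every power of q written through this root, scalar identities
    become rational in [r] and [l], within reach of [field]. *)
Definition rq : C := (Num.sqrt q)%:C.
Local Notation r := rq.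
Local Notation l := (lam phi).

Lemma rq_sqr : qC = r ^+ 2.
Proof.
have /andP[q0 _] := q01.
by rewrite /rq -rmorphXn /= sqr_sqrtr // ltW.
Qed.
Lemma rq_neq0 : r != 0.
Proof.
have /andP[q0 _] := q01; apply/eqP => r0; have := rq_sqr.
rewrite r0 expr0n /= => /eqP; rewrite fmorph_eq0 => /eqP q00.
by move: q0; rewrite q00 ltxx.
Qed.
Let l0 := lam_unit phi.
Let r0 := rq_neq0.
Let q0 : qC != 0. Proof. by rewrite rq_sqr expf_neq0. Qed.

(* A named product, so that equal monomials are syntactically equal whatever
   ring structure their product was elaborated with. *)
Definition mon2 (x y : su_gens) : A :=
  @gen C (SU q phi) x * @gen C (SU q phi) y.
Lemma mon2E x y : @gen C (SU q phi) x * @gen C (SU q phi) y = mon2 x y.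
Proof. by []. Qed.

Lemma mon2_ag : mon2 su_alpha su_gamma = (r ^+ 2 * l ^+ 2) *: mon2 su_gamma su_alpha.
Proof. by rewrite -rq_sqr; apply: su_agE. Qed.
Lemma mon2_ags : mon2 su_alpha su_gammas = (r ^+ 2 * l ^- 2) *: mon2 su_gammas su_alpha.
Proof. by rewrite -rq_sqr; apply: su_agsE. Qed.
Lemma mon2_asg :
  mon2 su_alphas su_gamma = (r ^+ 2 * l ^+ 2)^-1 *: mon2 su_gamma su_alphas.
Proof. by rewrite -rq_sqr; apply: su_asgE q01. Qed.
Lemma mon2_asgs :
  mon2 su_alphas su_gammas = (r ^+ 2 * l ^- 2)^-1 *: mon2 su_gammas su_alphas.
Proof. by rewrite -rq_sqr; apply: su_asgsE q01. Qed.
Lemma mon2_ggs : mon2 su_gamma su_gammas = mon2 su_gammas su_gamma.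
Proof. exact: su_ggsE. Qed.
Lemma mon2_aas : mon2 su_alpha su_alphas = one - r ^+ 4 *: mon2 su_gammas su_gamma.
Proof. by rewrite (exprM r 2 2) -rq_sqr; apply: su_aasE. Qed.
Lemma mon2_asa : mon2 su_alphas su_alpha = one - mon2 su_gammas su_gamma.
Proof. exact: su_asaE. Qed.
Let nf := (mon2E, mon2_ag, mon2_ags, mon2_asg, mon2_asgs, mon2_ggs, mon2_aas, mon2_asa).
Let oneE : (1 : A) = one. Proof. by []. Qed.

Section Torus.
Variables (s t : C) (s0 : s != 0) (t0 : t != 0).
(** The two-parameter torus of diagonal automorphisms. Inverse weights on the starred generators
    make the products in the two sphere relations invariant. *)
Definition torus_gen (x : su_gens) : A :=
  match x with
  | su_alpha => s *: al
  | su_gamma => t *: ga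
  | su_alphas => s^-1 *: als
  | su_gammas => t^-1 *: gas
  end.

Lemma torus_rel u v : su_rels q phi u v -> eval torus_gen u = eval torus_gen v.
Proof.
case=> /=; rewrite ?mulr_algl ?(expi4, expiN4) -?(scalerAl, scalerAr) ?nf ?oneE
  ?rq_sqr; lincomb C A; field; by rewrite ?l0 ?r0 ?s0 ?t0.
Qed.
Definition torus : A -> A := Defs.lift (P := SU q phi) torus_rel.
HB.instance Definition _ := GRing.LRMorphism.on torus.
Lemma torusE x : torus (gen x) = torus_gen x.
Proof. exact: lift_gen. Qed.
End Torus.

(** This is <k, alpha>, and [ks_weight] is <k^*, alpha>. The second leg of each term in the
    coproduct of a generator decides the weight, so alpha and gamma share it and their adjoints have
    the inverse. *)
Definition k_weight : C := r^-1 * l.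
Definition ks_weight : C := r^-1 * l^-1.
Local Notation kap := k_weight.
Local Notation kaps := ks_weight.
Lemma k_weight_neq0 : kap != 0. Proof. by rewrite mulf_neq0 ?invr_eq0. Qed.
Lemma ks_weight_neq0 : kaps != 0. Proof. by rewrite mulf_neq0 ?invr_eq0. Qed.

(** The values of sum lam^(|e| |a1|) <e, a2> a1 for a generator a, with <e, gamma^*> = - q^-1 l^-2;
    [f_der] is obtained likewise from <f, gamma> = 1. *)
Definition e_der (x : su_gens) : A := match x with
  | su_alphas => ga
  | su_gammas => - (r ^- 2 * l ^- 2) *: al
  | _ => 0
  end.
(** The diagonal comes from Delta e = e \ot k + k^-1 \ot e: on the right [k] acts, and on the left
    k^-1 acts, multiplied by lam^(-2 |a|) for braiding e past a. On gamma, of degree -2, this factor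
    is l^4. In [f_gen] it is lam^(2 |a|). *)
Definition e_gen (x : su_gens) : triang A :=
  (torus_gen kap^-1 (kap^-1 * l ^+ 4) x, e_der x, torus_gen kap kap x).

Definition f_der (x : su_gens) : A := match x with
  | su_alpha => - (r ^+ 2 * l ^+ 2) *: gas
  | su_gamma => als
  | _ => 0
  end.
Definition f_gen (x : su_gens) : triang A :=
  (torus_gen kaps^-1 (kaps^-1 * l ^- 4) x, f_der x, torus_gen kaps kaps x).

Lemma e_rel u v : su_rels q phi u v -> eval e_gen u = eval e_gen v.
Proof.
case=> /=; rewrite ?mulr_algl ?(expi4, expiN4) ?(triangM, triangZ, triangD, triang1) /=;
  (* The matrices are compared entry by entry; the corner entry says that the twisted Leibniz rule
     respects the relation. *)
  apply: (congr2 pair (congr2 pair _ _) _);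
  rewrite ?(mul0r, mulr0) -?(scalerAl, scalerAr) ?nf ?oneE ?rq_sqr;
  lincomb C A; rewrite /k_weight; field; by rewrite ?l0 ?r0.
Qed.

Lemma f_rel u v : su_rels q phi u v -> eval f_gen u = eval f_gen v.
Proof.
case=> /=; rewrite ?mulr_algl ?(expi4, expiN4) ?(triangM, triangZ, triangD, triang1) /=;
  apply: (congr2 pair (congr2 pair _ _) _);
  rewrite ?(mul0r, mulr0) -?(scalerAl, scalerAr) ?nf ?oneE ?rq_sqr;
  lincomb C A; rewrite /ks_weight; field; by rewrite ?l0 ?r0.
Qed.

End SUMaps.
Arguments torus {R q} phi q01 {s t} s0 t0 x.

(** * Skew derivations as corners of triangular homomorphisms *)

Section TriangularLift.
Variables (K : fieldType) (Q : presentation K).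
Local Notation A := (alg Q).
Variables (F : {lrmorphism A -> triang A}) (sg tau : {lrmorphism A -> A}).
Hypothesis F_sg : forall x, (F (gen x)).1.1 = sg (gen x).
Hypothesis F_tau : forall x, (F (gen x)).2 = tau (gen x).

Definition triang_der (a : A) : A := (F a).1.2.
Lemma triang_der_linear : linear triang_der.
Proof. by move=> c a b; rewrite /triang_der linearP. Qed.
HB.instance Definition _ :=
  GRing.isLinear.Build K A A *:%R triang_der triang_der_linear.

Lemma triang_diag a : (F a).1.1 = sg a /\ (F a).2 = tau a.
Proof.
elim/alg_ind: a => [//||a b [IHa IHa'] [IHb IHb']|c a [IH IH']|a b [IHa IHa'] [IHb IHb']].
- by rewrite !rmorph1 triang1.
- by rewrite !rmorphD /= -IHa -IHb -IHa' -IHb'.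
- by rewrite !linearZ /= -IH -IH'.
- by rewrite !rmorphM !triangM /= IHa IHb IHa' IHb'.
Qed.

Lemma triang_der_skew : skew_derivation sg tau triang_der.
Proof.
move=> a b; rewrite /triang_der rmorphM triangM /=.
by have [-> _] := triang_diag a; have [_ ->] := triang_diag b.
Qed.
End TriangularLift.

(** The algebra behind the relation for ef - fe on a product: the mixed terms in U V and S T cancel,
    and in P (X - Y) + (Z - W) N the two contributions of P N cancel. *)
Lemma commutator_telescope (K : fieldType) (B : algType K)
    (P X Y U V S T Z W N L M : B) (c d w : K) :
  X - Y = w *: (N - M) -> Z - W = w *: (L - P) ->
  P * X + (c *: U) * V + (S * (d *: T) + Z * N) -
    (P * Y + (d *: S) * T + (U * (c *: V) + W * N)) = w *: (L * N - P * M).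
Proof.
move=> /eqP; rewrite subr_eq => /eqP -> /eqP; rewrite subr_eq => /eqP ->.
have Zl a (x y : B) : (a *: x) * y = a *: (x * y) by rewrite scalerAl.
have Zr a (x y : B) : x * (a *: y) = a *: (x * y) by rewrite scalerAr.
rewrite !(mulrDl, mulrDr, scalerDr, mulrN, mulNr, scalerN, Zl, Zr).
move: (P * N) (P * M) (P * Y) (U * V) (S * T) (L * N) (W * N) => *.
by lincomb K B; field.
Qed.

(** * The operators of the generators and their relations *)

Section Action.
Variables (R : realType) (q phi : R) (q01 : 0 < q < 1).
Local Notation C := R[i].
Local Notation qC := (real_complex R q).
Local Notation A := (alg (SU q phi)).
Local Notation al := (@gen C (SU q phi) su_alpha).
Local Notation ga := (@gen C (SU q phi) su_gamma).
Local Notation als := (@gen C (SU q phi) su_alphas).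
Local Notation gas := (@gen C (SU q phi) su_gammas).
Local Notation r := (rq q).
Local Notation l := (lam phi).
Local Notation kap := (k_weight q phi).
Local Notation kaps := (ks_weight q phi).
Let l0 := lam_unit phi.
Let r0 := rq_neq0 q01.
Let k0 : kap != 0 := k_weight_neq0 phi q01.
Let ks0 : kaps != 0 := ks_weight_neq0 phi q01.
Let ki0 : kap^-1 != 0. Proof. by rewrite invr_eq0. Qed.
Let ksi0 : kaps^-1 != 0. Proof. by rewrite invr_eq0. Qed.
Let es0 : kap^-1 * l ^+ 4 != 0. Proof. by rewrite mulf_neq0 ?expf_neq0. Qed.
Let fs0 : kaps^-1 * l ^- 4 != 0. Proof. by rewrite mulf_neq0 ?invr_eq0 ?expf_neq0. Qed.

Definition k_op := torus phi q01 k0 k0.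
Definition ks_op := torus phi q01 ks0 ks0.
Definition ki_op := torus phi q01 ki0 ki0.
Definition ksi_op := torus phi q01 ksi0 ksi0.
Definition e_sg := torus phi q01 ki0 es0.
Definition f_sg := torus phi q01 ksi0 fs0.
HB.instance Definition _ := GRing.LRMorphism.on k_op.
HB.instance Definition _ := GRing.LRMorphism.on ks_op.
HB.instance Definition _ := GRing.LRMorphism.on ki_op.
HB.instance Definition _ := GRing.LRMorphism.on ksi_op.
HB.instance Definition _ := GRing.LRMorphism.on e_sg.
HB.instance Definition _ := GRing.LRMorphism.on f_sg.

Definition e_triang : A -> triang A := Defs.lift (P := SU q phi) (e_rel q01).
HB.instance Definition _ := GRing.LRMorphism.on e_triang.
Definition f_triang : A -> triang A := Defs.lift (P := SU q phi) (f_rel q01).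
HB.instance Definition _ := GRing.LRMorphism.on f_triang.
Definition e_op := triang_der e_triang.
HB.instance Definition _ := GRing.Linear.on e_op.
Definition f_op := triang_der f_triang.
HB.instance Definition _ := GRing.Linear.on f_op.

Lemma e_triangE x : e_triang (gen x) = e_gen q phi x.
Proof. exact: lift_gen. Qed.
Lemma f_triangE x : f_triang (gen x) = f_gen q phi x.
Proof. exact: lift_gen. Qed.
Lemma e_opE x : e_op (gen x) = e_der q phi x.
Proof. by rewrite /e_op /triang_der /= e_triangE. Qed.
Lemma f_opE x : f_op (gen x) = f_der q phi x.
Proof. by rewrite /f_op /triang_der /= f_triangE. Qed.

Lemma e_op_skew : skew_derivation e_sg k_op e_op.
Proof.
by apply: triang_der_skew => x /=; rewrite e_triangE [RHS]torusE.
Qed.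
Lemma f_op_skew : skew_derivation f_sg ks_op f_op.
Proof.
by apply: triang_der_skew => x /=; rewrite f_triangE [RHS]torusE.
Qed.

Lemma torus_comm s t (s0 : s != 0) (t0 : t != 0) s' t' (s0' : s' != 0) (t0' : t' != 0) a :
  torus phi q01 s0 t0 (torus phi q01 s0' t0' a) =
  torus phi q01 s0' t0' (torus phi q01 s0 t0 a).
Proof.
move: a; apply: (lrmorph_ext (f := torus phi q01 s0 t0 \o torus phi q01 s0' t0')
  (g := torus phi q01 s0' t0' \o torus phi q01 s0 t0)).
by case; rewrite /= !torusE /= !linearZ /= !torusE /= !scalerA mulrC.
Qed.

Ltac skew_comm_gen := let x := fresh in move=> x;
  rewrite /= /k_op /ks_op /e_sg /f_sg torusE ?(e_opE, f_opE); case: x => /=;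
  rewrite ?linearZ /= ?(e_opE, f_opE) /= ?linear0 ?linearZ /= ?torusE /=;
  lincomb C A; rewrite /k_weight /ks_weight; field; by rewrite ?l0 ?r0.

Lemma e_k a : e_op (k_op a) = (r ^+ 2 * l ^- 2) *: k_op (e_op a).
Proof.
move: a; apply: (skew_derivation_comm e_op_skew) => [x|x|];
  [exact: torus_comm|exact: torus_comm|skew_comm_gen].
Qed.

Lemma e_ks a : e_op (ks_op a) = (r ^+ 2 * l ^+ 2) *: ks_op (e_op a).
Proof.
move: a; apply: (skew_derivation_comm e_op_skew) => [x|x|];
  [exact: torus_comm|exact: torus_comm|skew_comm_gen].
Qed.

Lemma f_k a : f_op (k_op a) = (r ^+ 2 * l ^- 2)^-1 *: k_op (f_op a).
Proof.
move: a; apply: (skew_derivation_comm f_op_skew) => [x|x|];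
  [exact: torus_comm|exact: torus_comm|skew_comm_gen].
Qed.

Lemma f_ks a : f_op (ks_op a) = (r ^+ 2 * l ^+ 2)^-1 *: ks_op (f_op a).
Proof.
move: a; apply: (skew_derivation_comm f_op_skew) => [x|x|];
  [exact: torus_comm|exact: torus_comm|skew_comm_gen].
Qed.

(** The constant is that of [e_ks], and the constant of [e_fsg] is that of [f_k]. These coincidences
    cancel the mixed terms in [e_f]. *)
Lemma f_esg a : f_op (e_sg a) = (r ^+ 2 * l ^+ 2) *: e_sg (f_op a).
Proof.
move: a; apply: (skew_derivation_comm f_op_skew) => [x|x|];
  [exact: torus_comm|exact: torus_comm|skew_comm_gen].
Qed.

Lemma e_fsg a : e_op (f_sg a) = (r ^+ 2 * l ^- 2)^-1 *: f_sg (e_op a).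
Proof.
move: a; apply: (skew_derivation_comm e_op_skew) => [x|x|];
  [exact: torus_comm|exact: torus_comm|skew_comm_gen].
Qed.

Lemma k_ki a : k_op (ki_op a) = a.
Proof.
move: a; apply: (lrmorph_ext (f := k_op \o ki_op) (g := idfun)) => x /=.
rewrite /ki_op /k_op torusE; case: x; rewrite /= linearZ /= torusE /= scalerA;
  by rewrite ?mulVf ?mulfV ?scale1r // invr_eq0.
Qed.
Lemma ki_k a : ki_op (k_op a) = a.
Proof. by rewrite -[RHS]k_ki; apply: torus_comm. Qed.
Lemma ks_ksi a : ks_op (ksi_op a) = a.
Proof.
move: a; apply: (lrmorph_ext (f := ks_op \o ksi_op) (g := idfun)) => x /=.
rewrite /ksi_op /ks_op torusE; case: x; rewrite /= linearZ /= torusE /= scalerA;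
  by rewrite ?mulVf ?mulfV ?scale1r // invr_eq0.
Qed.
Lemma ksi_ks a : ksi_op (ks_op a) = a.
Proof. by rewrite -[RHS]ks_ksi; apply: torus_comm. Qed.

(** The braiding twists of [e_sg] and [f_sg] are inverse to each other. *)
Lemma esg_fsg a : e_sg (f_sg a) = ki_op (ksi_op a).
Proof.
move: a; apply: (lrmorph_ext (f := e_sg \o f_sg) (g := ki_op \o ksi_op)) => x /=.
rewrite /e_sg /f_sg /ki_op /ksi_op !torusE.
case: x; rewrite /= !linearZ /= !torusE /= !scalerA; congr (_ *: _);
  rewrite /k_weight /ks_weight; field; by rewrite ?l0 ?r0.
Qed.

Lemma e_f a : e_op (f_op a) - f_op (e_op a) =
  (qC^-1 - qC)^-1 *: (k_op (ks_op a) - ki_op (ksi_op a)).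
Proof.
(* This is 1 - q^2, nonzero because 0 < q < 1; it makes q^-1 - q invertible in the checks on
   generators. *)
have w0 : 1 - r ^+ 2 * r ^+ 2 != 0.
  have /andP[q_gt0 q_lt1] := q01.
  rewrite -(rq_sqr q01) -rmorphM -(rmorph1 (real_complex R)) -rmorphB fmorph_eq0.
  by rewrite subr_eq0 gt_eqF // mulr_ilt1 // ltW.
rewrite (rq_sqr q01); set w := (_ - _)^-1.
elim/alg_ind: a => [x||a b IH IH'|c a IH|a b IHa IHb].
- rewrite /k_op /ks_op /ki_op /ksi_op !torusE e_opE f_opE.
  case: x; rewrite /= ?linearZ /= ?(e_opE, f_opE) /= ?linear0 ?linearZ /=
      ?(e_opE, f_opE) ?torusE /=;
    lincomb C A; rewrite /w /k_weight /ks_weight; field; rewrite ?l0 ?r0 //= mulNr;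
    exact: w0.
- have /= -> := rmorph1 ksi_op; have /= -> := rmorph1 ki_op.
  have /= -> := rmorph1 ks_op; have /= -> := rmorph1 k_op.
  rewrite (skew_derivation1 e_op_skew) (skew_derivation1 f_op_skew).
  by rewrite !linear0 !subrr scaler0 addr0.
- by rewrite !linearD /= addrACA IH IH' !scalerDr addrACA.
- by rewrite !linearZ /= -!scalerDr IH !scalerA mulrC.
rewrite f_op_skew e_op_skew [e_op (_ + _)]linearD [f_op (_ + _)]linearD /=.
rewrite !e_op_skew !f_op_skew e_fsg f_k f_esg e_ks.
rewrite /ki_op /ksi_op /k_op /ks_op !rmorphM /= -/k_op -/ks_op -/ki_op -/ksi_op.
have -> : f_sg (e_sg a) = e_sg (f_sg a) by apply: torus_comm.
have -> : ks_op (k_op b) = k_op (ks_op b) by apply: torus_comm.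
rewrite -!esg_fsg; apply: commutator_telescope => //.
  by rewrite esg_fsg.
by rewrite esg_fsg.
Qed.

End Action.
Arguments e_op {R q} phi q01 a.
Arguments f_op {R q} phi q01 a.
Arguments k_op {R q} phi q01 a.
Arguments ks_op {R q} phi q01 a.
Arguments ki_op {R q} phi q01 a.
Arguments ksi_op {R q} phi q01 a.
Arguments e_sg {R q} phi q01 a.
Arguments f_sg {R q} phi q01 a.
Arguments e_op_skew {R q} phi q01 a b.
Arguments f_op_skew {R q} phi q01 a b.

(** * The action of [Uhat] on [SU] and its compatibilities on generators *)

Section Pairing.
Variables (R : realType) (q phi : R) (q01 : 0 < q < 1).
Local Notation C := R[i].
Local Notation qC := (real_complex R q).
Local Notation H := (alg (Uhat q phi)).
Local Notation A := (alg (SU q phi)).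
Local Notation g := (@gen C (SU q phi)).
Local Notation h := (@gen C (Uhat q phi)).
Local Notation al := (@gen C (SU q phi) su_alpha).
Local Notation ga := (@gen C (SU q phi) su_gamma).
Local Notation als := (@gen C (SU q phi) su_alphas).
Local Notation gas := (@gen C (SU q phi) su_gammas).
Local Notation r := (rq q).
Local Notation l := (lam phi).
Local Notation kap := (k_weight q phi).
Local Notation kaps := (ks_weight q phi).
Local Notation lam0 := (lam_unit phi).
Let r0 := rq_neq0 q01.
Let l0 := lam_unit phi.

Definition u_op (x : u_gens) : {linear A -> A} := match x with
  | u_e => e_op phi q01
  | u_f => f_op phi q01
  | u_k => k_op phi q01
  | u_ks => ks_op phi q01
  | u_ki => ki_op phi q01
  | u_ksi => ksi_op phi q01
  end.

Lemma u_op_rel s t : u_rels q phi s t ->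
  term_act (P := Uhat q phi) u_op s =1 term_act (P := Uhat q phi) u_op t.
Proof.
have q2 := rq_sqr q01.
case=> a /=; rewrite ?scale1r ?scaleN1r ?(expi4, expiN4) ?q2.
- exact: e_k.
- by rewrite f_k scalerA mulfV ?scale1r // mulf_neq0 ?invr_eq0 ?expf_neq0.
- by rewrite f_ks scalerA mulfV ?scale1r // mulf_neq0 ?expf_neq0.
- exact: e_ks.
- exact: torus_comm.
- by rewrite e_f q2.
- exact: k_ki.
- exact: ki_k.
- exact: ks_ksi.
- exact: ksi_ks.
Qed.

Definition u_act : H \ot A -> A := rep (P := Uhat q phi) u_op_rel.
HB.instance Definition _ := GRing.Linear.on u_act.

Lemma u_act_gen x a : u_act (h x \ot a) = u_op x a.
Proof. exact: rep_gen. Qed.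

(** Closed forms of the operators on generators, so that the later case checks reduce by
    computation. *)
Definition u_op_val (x : u_gens) (y : su_gens) : A := match x with
  | u_e => e_der q phi y
  | u_f => f_der q phi y
  | u_k => torus_gen q phi kap kap y
  | u_ks => torus_gen q phi kaps kaps y
  | u_ki => torus_gen q phi kap^-1 kap^-1 y
  | u_ksi => torus_gen q phi kaps^-1 kaps^-1 y
  end.
Lemma u_op_gen x y : u_op x (g y) = u_op_val x y.
Proof. by case: x; [exact: e_opE|exact: f_opE|..]; exact: torusE. Qed.

Lemma u_Delta1 : u_Delta phi q01 1 = 1 \ot 1.
Proof.
exact: (lift_monoid_morphism (P := Uhat q phi) (u_Delta_rel (phi := phi) q01)).1.
Qed.
Lemma u_DeltaM (x y : H) :
  u_Delta phi q01 (x * y) = btens_mul lam0 (u_Delta phi q01 x) (u_Delta phi q01 y).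
Proof.
exact: (lift_monoid_morphism (P := Uhat q phi) (u_Delta_rel (phi := phi) q01)).2.
Qed.
Lemma u_Delta_genE x : u_Delta phi q01 (h x) = u_Delta_gen q phi x.
Proof. exact: (lift_gen (P := Uhat q phi) (u_Delta_rel (phi := phi) q01)). Qed.
Lemma su_Delta1 : su_Delta phi q01 1 = 1 \ot 1.
Proof.
exact: (lift_monoid_morphism (P := SU q phi) (su_Delta_rel (phi := phi) q01)).1.
Qed.
Lemma su_DeltaM (x y : A) :
  su_Delta phi q01 (x * y) = btens_mul lam0 (su_Delta phi q01 x) (su_Delta phi q01 y).
Proof.
exact: (lift_monoid_morphism (P := SU q phi) (su_Delta_rel (phi := phi) q01)).2.
Qed.
Lemma su_Delta_genE x : su_Delta phi q01 (g x) = su_Delta_gen q phi x.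
Proof. exact: (lift_gen (P := SU q phi) (su_Delta_rel (phi := phi) q01)). Qed.
Lemma u_S1 : u_S phi q01 1 = 1.
Proof.
exact: (lift_monoid_morphism (P := Uhat q phi) (u_S_rel (phi := phi) q01)).1.
Qed.
Lemma u_SM (x y : H) :
  u_S phi q01 (x * y) = bopp_mul lam0 (u_S phi q01 x) (u_S phi q01 y).
Proof.
exact: (lift_monoid_morphism (P := Uhat q phi) (u_S_rel (phi := phi) q01)).2.
Qed.
Lemma u_S_genE x : u_S phi q01 (h x) = u_S_gen q phi x.
Proof. exact: (lift_gen (P := Uhat q phi) (u_S_rel (phi := phi) q01)). Qed.
Lemma su_S1 : su_S phi q01 1 = 1.
Proof.
exact: (lift_monoid_morphism (P := SU q phi) (su_S_rel (phi := phi) q01)).1.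
Qed.
Lemma su_SM (x y : A) :
  su_S phi q01 (x * y) = bopp_mul lam0 (su_S phi q01 x) (su_S phi q01 y).
Proof.
exact: (lift_monoid_morphism (P := SU q phi) (su_S_rel (phi := phi) q01)).2.
Qed.
Lemma su_S_genE x : su_S phi q01 (g x) = su_S_gen q phi x.
Proof. exact: (lift_gen (P := SU q phi) (su_S_rel (phi := phi) q01)). Qed.

Let uDE := u_Delta_genE.
Let suDE := su_Delta_genE.

Lemma u_Delta_gen_graded x :
  tgraded (@homog C (Uhat q phi)) (u_deg x) (u_Delta phi q01 (h x)).
Proof.
have hg y := homog_gen (P := Uhat q phi) y.
rewrite uDE; case: x => /=; do ?[apply: tgraded_add];
  by apply: tgraded_pure; [exact: hg|exact: hg|].
Qed.

Lemma su_Delta_gen_graded x :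
  tgraded (@homog_gen_span C (SU q phi)) (su_deg x) (su_Delta phi q01 (g x)).
Proof.
have hg y : homog_gen_span (su_deg y) (g y).
  by split; [exact: (homog_gen (P := SU q phi) y)|exact: gen_span_gen].
have hZ n c (a : A) : homog_gen_span n a -> homog_gen_span n (c *: a).
  by move=> [? ?]; split; [apply: homogZ|apply: gen_spanZ].
rewrite suDE; case: x => /=; rewrite -?scaleNr; apply: tgraded_add;
  rewrite ?scaleNr -?scaleNr; do ?[apply: tgradedZ; first exact: hZ];
  by apply: tgraded_pure; [exact: hg|exact: hg|].
Qed.

Lemma u_deg_counit (x : u_gens) : u_deg x != 0 -> u_counit R x = 0.
Proof. by case: x. Qed.
Lemma su_deg_counit (x : su_gens) : su_deg x != 0 -> su_counit R x = 0.
Proof. by case: x. Qed.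

Lemma counit_su_gen x : counit (g x) = su_counit R x.
Proof. exact: lift_gen. Qed.
Lemma counit_u_gen x : counit (h x) = u_counit R x.
Proof. exact: lift_gen. Qed.

Lemma su_counitr_gen x : counitr (su_Delta phi q01 (g x)) = g x.
Proof.
rewrite suDE; case: x => /=; rewrite ?linearD ?linearN ?linearZ /= !counitrE
  !counit_su_gen /= ?scale1r ?scale0r ?oppr0 ?scaler0 ?addr0 //.
Qed.

Section TorusGrading.
Variables (s t t' : C) (s0 : s != 0) (t0 : t != 0) (t0' : t' != 0).

Lemma torus_homog n a : homog n a -> homog n (torus phi q01 s0 t0 a).
Proof.
move: n a; apply: homog_rec.
- by move=> x; rewrite torusE; case: x; apply: homogZ; apply: (homog_gen (P := SU q phi)).
- by rewrite rmorph1; apply: homog1.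
- by move=> n; rewrite raddf0; apply: homog0.
- by move=> n a b ha hb; rewrite linearD; apply: homogD.
- by move=> n c a ha; rewrite linearZ; apply: homogZ.
- by move=> m n a b _ _ ha hb; rewrite rmorphM; apply: homogM.
Qed.

(** Multiplying degree n by l^(m n) is itself a torus automorphism: it fixes alpha and its adjoint,
    and scales gamma, of degree -2, by l^(-2 m). *)
Lemma torus_twist (m : int) : t' = l ^ (m * -2) * t ->
  forall n a, homog n a -> torus phi q01 s0 t0' a = l ^ (m * n) *: torus phi q01 s0 t0 a.
Proof.
move=> t'E; apply: homog_rec.
- move=> x; rewrite !torusE.
  case: x; rewrite /= ?mulr0 ?expr0z ?scale1r ?scalerA // t'E //.
  by rewrite invfM invr_expz -mulrN.
- by rewrite !rmorph1 mulr0 expr0z scale1r.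
- by move=> n; rewrite !raddf0.
- by move=> n a b IH IH'; rewrite !linearD /= IH IH' ?scalerDr.
- by move=> n c a IH; rewrite !linearZ /= IH !scalerA mulrC.
move=> p n a b _ _ IH IH'; rewrite !rmorphM /= IH IH'.
by rewrite -scalerAl -scalerAr scalerA -expfzDr // mulrDr.
Qed.
End TorusGrading.


Lemma e_der_homog x : homog (-2 + su_deg x) (e_der q phi x).
Proof.
case: x; [exact: homog0|exact: homog0|exact: (homog_gen (P := SU q phi) su_gamma)|].
apply: homogZ; exact: (homog_gen (P := SU q phi) su_alpha).
Qed.
Lemma f_der_homog x : homog (2 + su_deg x) (f_der q phi x).
Proof.
case: x; [|exact: (homog_gen (P := SU q phi) su_alphas)|exact: homog0|exact: homog0].
apply: homogZ; exact: (homog_gen (P := SU q phi) su_gammas).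
Qed.

Lemma u_act_gen_homog x n a : homog n a -> homog (u_deg x + n) (u_act (h x \ot a)).
Proof.
rewrite u_act_gen; case: x => ha /=; rewrite ?add0r; try exact: torus_homog.
- move: n a ha; apply: (skew_derivation_homog (e_op_skew phi q01)) => [||x];
    [exact: torus_homog|exact: torus_homog|by rewrite /= e_opE; exact: e_der_homog].
- move: n a ha; apply: (skew_derivation_homog (f_op_skew phi q01)) => [||x];
    [exact: torus_homog|exact: torus_homog|by rewrite /= f_opE; exact: f_der_homog].
Qed.

Lemma u_act_gen_unit x : u_act (h x \ot 1) = (counit (h x) : C) *: (1 : A).
Proof.
rewrite u_act_gen counit_u_gen; case: x; rewrite /= ?scale0r ?scale1r;
  [exact: skew_derivation1 (e_op_skew phi q01)|
   exact: skew_derivation1 (f_op_skew phi q01)|exact: rmorph1..].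
Qed.

Lemma u_tact_gen x y n a b : homog n a ->
  tact lam0 u_act (h x \ot h y \ot (a \ot b)) =
  l ^ (u_deg y * n) *: (u_op x a \ot u_op y b).
Proof.
by move=> ha; rewrite (tactE lam0 _ _ _ (homog_gen (P := Uhat q phi) y) ha) /= !u_act_gen.
Qed.

Lemma u_act_gen_mul x a b : u_act (h x \ot (a * b)) =
  tmul (tact lam0 u_act (u_Delta phi q01 (h x) \ot (a \ot b))).
Proof.
elim/homog_ind: a => [n a ha|a a' IH IH']; last first.
  by rewrite mulrDl pureDr pureDl pureDr !linearD /= IH IH'.
rewrite uDE u_act_gen; case: x;
  rewrite /= ?pureDl ?linearD /= !(u_tact_gen _ _ _ ha) ?linearZ /= !tmulE ?mul0r
    ?expr0z ?scale1r ?rmorphM //.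
- rewrite e_op_skew addrC; congr (_ + _).
  (* The left twist of the skew derivation is k^-1 together with the factor from braiding e, of
     degree -2, past [a]. *)
  have -> : e_sg phi q01 a = l ^ (-2 * n) *: ki_op phi q01 a.
    by apply: torus_twist ha; apply: mulrC.
  by rewrite scalerAl.
- rewrite f_op_skew addrC; congr (_ + _).
  have -> : f_sg phi q01 a = l ^ (2 * n) *: ksi_op phi q01 a.
    by apply: torus_twist ha; apply: mulrC.
  by rewrite scalerAl.
Qed.

Lemma u_act_gen_span x y : gen_span (u_act (h x \ot g y)).
Proof.
rewrite u_act_gen u_op_gen; case: x; case: y => /=; do ?[apply: gen_spanZ];
  first [exact: gen_span0|exact: gen_span_gen].
Qed.

Lemma u_coact_gen x y z : coact lam0 u_act (h x \ot (g y \ot g z)) =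
  l ^ (u_deg x * su_deg y) *: (g y \ot u_op_val x z).
Proof.
rewrite (coactE lam0 _ _ (homog_gen (P := Uhat q phi) x) (homog_gen (P := SU q phi) y)).
by rewrite /= u_act_gen u_op_gen.
Qed.

Let twE := (mul0r, mulr0, expr0z, scale1r, scaleN1r,
  erefl : l ^ (-2 * -2) = l ^+ 4, erefl : l ^ (2 * 2) = l ^+ 4,
  erefl : l ^ (-2 * 2) = l ^- 4, erefl : l ^ (2 * -2) = l ^- 4).

Lemma u_coprod_act_gen x y : su_Delta phi q01 (u_act (h x \ot g y)) =
  coact lam0 u_act (h x \ot su_Delta phi q01 (g y)).
Proof.
have D0 : su_Delta phi q01 0 = 0 := linear0 _.
have DZ c a : su_Delta phi q01 (c *: a) = c *: su_Delta phi q01 a := linearZ _ _.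
(* With linearity stated for a named map, all 24 cases reduce to combinations of tensors of
   generators. *)
pose T := coact lam0 u_act.
have TD v w : T (v + w) = T v + T w := linearD _ _ _.
have TN v : T (- v) = - T v := linearN _ _.
have TZ c v : T (c *: v) = c *: T v := linearZ _ _.
have Tg x1 y1 z1 : T (h x1 \ot (g y1 \ot g z1)) = _ := u_coact_gen x1 y1 z1.
rewrite u_act_gen u_op_gen -/T.
case: x; case: y; rewrite /= ?D0 ?DZ !suDE /=
  ?(pureDr, pureNr, pureZr) ?TD ?TN ?TZ ?Tg /=
  ?(pure0r, pureZr) ?twE ?(expi4, expiN4) ?(rq_sqr q01);
  lincomb C (A \ot A)%type; rewrite /k_weight /ks_weight; field; by rewrite ?l0 ?r0.
Qed.

End Pairing.
Arguments u_act {R q} phi q01 x.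

(** * Antipodes and values on generators *)

Section Values.
Variables (R : realType) (q phi : R) (q01 : 0 < q < 1).
Local Notation C := R[i].
Local Notation qC := (real_complex R q).
Local Notation H := (alg (Uhat q phi)).
Local Notation A := (alg (SU q phi)).
Local Notation g := (@gen C (SU q phi)).
Local Notation h := (@gen C (Uhat q phi)).
Local Notation r := (rq q).
Local Notation l := (lam phi).
Local Notation lam0 := (lam_unit phi).
Let r0 := rq_neq0 q01.
Let l0 := lam_unit phi.
Let uDE := @u_Delta_genE R q phi q01.
Let suDE := @su_Delta_genE R q phi q01.
Let twE := (mul0r, mulr0, expr0z, scale1r, scaleN1r,
  erefl : l ^ (-2 * -2) = l ^+ 4, erefl : l ^ (2 * 2) = l ^+ 4,
  erefl : l ^ (-2 * 2) = l ^- 4, erefl : l ^ (2 * -2) = l ^- 4).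

Lemma u_S_gen_homog x : homog (u_deg x) (u_S phi q01 (h x)).
Proof.
have hg y := homog_gen (P := Uhat q phi) y.
rewrite u_S_genE; case: x; [apply: homogZ; exact: (hg u_e)|
  apply: homogZ; exact: (hg u_f)|exact: (hg u_ki)|exact: (hg u_ksi)|
  exact: (hg u_k)|exact: (hg u_ks)].
Qed.

Lemma su_S_gen_homog x : homog (su_deg x) (su_S phi q01 (g x)).
Proof.
have hg y := homog_gen (P := SU q phi) y.
rewrite su_S_genE; case: x; [exact: (hg su_alphas)|
  apply: homogZ; exact: (hg su_gamma)|exact: (hg su_alpha)|
  apply: homogZ; exact: (hg su_gammas)].
Qed.

Lemma u_flip_gen x y : braided_flip_antipode lam0 (u_S phi q01) (h x \ot h y) =
  l ^ (u_deg x * u_deg y) *: ((u_S_gen q phi y : H) \ot (u_S_gen q phi x : H)).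
Proof.
rewrite (braided_flip_antipodeE (u_S1 phi q01) (u_SM q01) u_S_gen_homog
  (homog_gen (P := Uhat q phi) x) (homog_gen (P := Uhat q phi) y)).
by rewrite /= !u_S_genE.
Qed.

Lemma su_flip_gen x y : braided_flip_antipode lam0 (su_S phi q01) (g x \ot g y) =
  l ^ (su_deg x * su_deg y) *: ((su_S_gen q phi y : A) \ot (su_S_gen q phi x : A)).
Proof.
rewrite (braided_flip_antipodeE (su_S1 phi q01) (su_SM q01) su_S_gen_homog
  (homog_gen (P := SU q phi) x) (homog_gen (P := SU q phi) y)).
by rewrite /= !su_S_genE.
Qed.

Lemma u_coprod_antipode_gen x : u_Delta phi q01 (u_S phi q01 (h x)) =
  braided_flip_antipode lam0 (u_S phi q01) (u_Delta phi q01 (h x)).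
Proof.
rewrite u_S_genE uDE; case: x;
  rewrite /= ?linearZ /= !uDE /= ?linearD /= !u_flip_gen /=
    ?(pureDr, pureDl, pureZl, pureZr) ?twE ?(expi4, expiN4) ?(rq_sqr q01);
  lincomb C (H \ot H)%type; field; by rewrite ?l0 ?r0.
Qed.

Lemma su_coprod_antipode_gen x : su_Delta phi q01 (su_S phi q01 (g x)) =
  braided_flip_antipode lam0 (su_S phi q01) (su_Delta phi q01 (g x)).
Proof.
rewrite su_S_genE suDE; case: x;
  rewrite /= ?linearZ /= !suDE /= ?linearD ?linearN ?linearZ /= !su_flip_gen /=
    ?(pureDr, pureDl, pureZl, pureZr) ?twE ?(expi4, expiN4) ?(rq_sqr q01);
  lincomb C (A \ot A)%type; field; by rewrite ?l0 ?r0.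
Qed.

Lemma u_counit_antipode_gen x : counit (u_S phi q01 (h x)) = counit (h x).
Proof.
by rewrite u_S_genE; case: x; rewrite /= ?linearZ /= !counit_u_gen /= ?scaler0.
Qed.

Lemma su_counit_antipode_gen x : counit (su_S phi q01 (g x)) = counit (g x).
Proof.
by rewrite su_S_genE; case: x; rewrite /= ?linearZ /= !counit_su_gen /= ?scaler0.
Qed.

Local Notation p := (pairing (u_act phi q01)).

Lemma pairing_genE x y : p (h x \ot g y) = pairing_gen q phi x y.
Proof.
have e2 : expi (2 * phi) = l by [].
have eN2 : expi (- 2 * phi) = l^-1 by rewrite mulNr expiN.
rewrite /pairing /= u_act_gen u_op_gen /pairing_gen -/(rq q).
case: x; case: y;
  rewrite /= ?linear0 ?linearZ /= ?counit_su_gen /= ?scaler0 // [LHS]mulr1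
    ?e2 ?eN2 ?expiN4 ?(rq_sqr q01) // /k_weight /ks_weight;
  field; by rewrite ?l0 ?r0.
Qed.

Lemma pairing_antipode_gen x y :
  p (u_S phi q01 (h x) \ot g y) = p (h x \ot su_S phi q01 (g y)).
Proof.
have e2 : expi (2 * phi) = l by [].
have eN2 : expi (- 2 * phi) = l^-1 by rewrite mulNr expiN.
rewrite u_S_genE su_S_genE; case: x; case: y;
  rewrite /= ?(pureZl, pureZr) ?linearZ /= !pairing_genE /pairing_gen -/(rq q)
    ?scaler0 //;
  rewrite /GRing.scale /= ?e2 ?eN2 ?(expi4, expiN4) ?(rq_sqr q01) ?mulr1;
  field; by rewrite ?l0 ?r0.
Qed.

End Values.

(** * The braided pairing of [Uhat] and [SU] *)

Theorem theorem3p12 (R : realType) (q phi : R)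
    (q01 : 0 < q < 1) (phi_bounds : 0 <= phi < 2 * pi) :
  let H := alg (Uhat q phi) in
  let A := alg (SU q phi) in
  exists p : {linear (H \ot A)%type -> R[i]^o},
    [/\ braided_pairing
          (u_Delta phi q01) (u_S phi q01) (@counit _ (Uhat q phi))
          (su_Delta phi q01) (su_S phi q01) (@counit _ (SU q phi))
          (Xi q phi) p,
        forall (x : u_gens) (y : su_gens),
          p (@gen _ (Uhat q phi) x \ot @gen _ (SU q phi) y) = pairing_gen q phi x y,
        pairing_slideA (su_Psi q phi) (Xi q phi) p &
        pairing_slideH (u_Psi q phi) (Xi q phi) p].
Proof.
move=> H A.
exists (pairing (u_act phi q01)); split.
(* The general construction leaves the structural properties of the coproducts, antipodes and
   action, and the checks on generators. *)
- apply: pairing_braided.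
  + exact: u_Delta1.
  + exact: u_DeltaM.
  + exact: u_Delta_gen_graded.
  + exact: su_Delta1.
  + exact: su_DeltaM.
  + exact: su_Delta_gen_graded.
  + exact: u_deg_counit.
  + exact: su_deg_counit.
  + exact: su_counitr_gen.
  + exact: rep1.
  + exact: repM.
  + exact: u_act_gen_homog.
  + exact: u_act_gen_unit.
  + exact: u_act_gen_mul.
  + exact: u_act_gen_span.
  + exact: u_coprod_act_gen.
  + exact: u_S1.
  + exact: u_SM.
  + exact: u_S_gen_homog.
  + exact: su_S1.
  + exact: su_SM.
  + exact: su_S_gen_homog.
  + exact: u_coprod_antipode_gen.
  + exact: su_coprod_antipode_gen.
  + exact: u_counit_antipode_gen.
  + exact: su_counit_antipode_gen.
  + exact: pairing_antipode_gen.
- exact: pairing_genE.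
- apply: pairing_slide_target.
  + exact: su_deg_counit.
  + exact: rep1.
  + exact: repM.
  + exact: u_act_gen_homog.
- apply: pairing_slide_source.
  + exact: su_deg_counit.
  + exact: rep1.
  + exact: repM.
  + exact: u_act_gen_homog.
Qed.
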